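(* Let $\mathbb T$ be the regular tree in which every vertex has $q+1$ neighbours, $q\ge 2$, with root $e$, graph metric $d$ and $|x|=d(e,x)$. For $d\in\mathbb N_0$ let $P_d$ be the transition matrix with $p_d(x,y)=\frac{1}{(q+1)q^{d-1}}$ if $d(x,y)=d$ (for $d\ge1$) and $0$ otherwise, $P_0=I$. Let $P=\sum_{d=0}^\infty a_d P_d$ with $a_d\ge 0$, $\sum_d a_d=1$, $a_d>0$ for at least one odd and at least one even $d$, and with super-exponential moments: $\limsup_{d\to\infty}a_d^{1/d}=0$. Let $\rho$ be the spectral radius of $P$. Then the ratio limit theorem holds with ratio limit kernel $H(x,y)=\varphi(d(x,y))/\varphi(|y|)$, where $\varphi(n)=\bigl(1+\frac{q-1}{q+1}n\bigr)q^{-n/2}$; the ratio limit compactification of $(\mathbb T,P)$ coincides analytically with the $\rho$-Martin compactification of $(\mathbb T,P)$; geometrically both are the end compactification $\mathbb T\cup\partial\mathbb T$, and for every $x\in\mathbb T$ and every end $\xi\in\partial\mathbb T$, $$K(x,\xi|\rho)=H(x,\xi)=q^{-\mathrm{hor}(x,\xi)/2}.$$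
   Context: General setting: $X$ is a countable set with a fixed root $e$, $P=(p(x,y))_{x,y\in X}$ is a stochastic transition matrix, irreducible and aperiodic (for all $x,y$ there is $k$ with $p^{(n)}(x,y)>0$ for all $n\ge k$, where $p^{(n)}$ are the $n$-step transition probabilities). The spectral radius is $\rho=\limsup_n p^{(n)}(x,y)^{1/n}$ (independent of $x,y$), and $r=1/\rho$. A ratio limit theorem holds if $h(x,y)=\lim_{n\to\infty}p^{(n)}(x,y)/p^{(n)}(e,e)\in(0,\infty)$ exists for all $x,y$; the ratio limit kernel is $H(x,y)=h(x,y)/h(e,y)$. The ratio limit compactification is the (up to homeomorphism fixing $X$) unique compact Hausdorff space containing $X$ as a discrete, open, dense subset such that each $H(x,\cdot)$ extends continuously to it and, for distinct boundary points $\xi\ne\eta$, there is $x\in X$ with $H(x,\xi)\neq H(x,\eta)$ (extended kernels also denoted $H$). The Green function is $G(x,y|z)=\sum_{n\ge0}p^{(n)}(x,y)z^n$, $F(x,y|z)=G(x,y|z)/G(y,y|z)$ (finite at $z=r$), and the $\rho$-Martin kernel is $K(x,y|\rho)=F(x,y|r)/F(e,y|r)$; the $\rho$-Martin compactification is defined as the ratio limit compactification but with $K(\cdot,\cdot|\rho)$ in place of $H$ (extended kernel also denoted $K(x,\xi|\rho)$). Two compactifications of $X$ coincide geometrically if the identity of $X$ extends to a homeomorphism between them; the $\rho$-Martin and ratio limit compactifications coincide analytically if there is such a homeomorphism $\tau$ from the $\rho$-Martin compactification onto the ratio limit compactification with $K(x,\xi|\rho)=H(x,\tau(\xi))$ for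 all $x\in X$ and all boundary points $\xi$. Tree notions: a ray is a one-sided infinite path of distinct successively adjacent vertices; two rays are equivalent if they differ by finitely many initial vertices; an end is an equivalence class of rays, $\partial\mathbb T$ is the set of ends. For $x\in\mathbb T$ and $w\in\mathbb T\cup\partial\mathbb T$ let $\pi(x,w)$ be the unique geodesic (or ray) from $x$ to $w$. The end compactification $\mathbb T\cup\partial\mathbb T$ has $\mathbb T$ discrete and, as neighbourhood basis of $\xi\in\partial\mathbb T$, the sets $\{w: x\in\pi(e,w)\}$, $x\in\pi(e,\xi)$. The confluent $v\wedge w$ of distinct $v,w$ is the vertex of $\pi(e,v)\cap\pi(e,w)$ furthest from $e$. The horocycle index is $\mathrm{hor}(x,\xi)=d(x,x\wedge\xi)-|x\wedge\xi|=\lim_{y\to\xi}\bigl(d(x,y)-|y|\bigr)$. *)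

(* Defs.v *)
From HB Require Import structures.
From mathcomp Require Import all_boot all_order all_algebra.
From mathcomp Require Import all_classical all_reals all_analysis.
Set Implicit Arguments. Unset Strict Implicit. Unset Printing Implicit Defensive.
Import Order.TTheory GRing.Theory Num.Theory.
Import numFieldNormedType.Exports.
Local Open Scope classical_set_scope.
Local Open Scope ring_scope.

(* Vertices: finite words [a0; a1; ...; a(n-1)] with a0 <= q (q+1 choices)
   and ai < q for i >= 1 (q choices); the root e is the empty word; the
   neighbours of w are its parent (drop last letter) and its children.  *)
Definition is_vert (q : nat) (w : seq nat) : bool :=
  match w with
  | [::] => true
  | a :: s => (a <= q)%N && all (fun b => (b < q)%N) s
  end.

Definition vert (q : nat) := {w : seq nat | is_vert q w}.

Definition troot (q : nat) : vert q := exist _ [::] isT.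

Fixpoint lcp (v w : seq nat) : nat :=
  match v, w with
  | a :: v', b :: w' => if a == b then (lcp v' w').+1 else 0%N
  | _, _ => 0%N
  end.

Definition wdist (v w : seq nat) : nat := (size v + size w - 2 * lcp v w)%N.
Definition dist (q : nat) (x y : vert q) : nat := wdist (val x) (val y).
Definition vnorm (q : nat) (x : vert q) : nat := size (val x).

(* Ends: an end is identified with the unique ray pi(e,xi) from the root,
   i.e. an infinite word with f 0 <= q and f (n+1) < q. *)
Definition endT (q : nat) :=
  {f : nat -> nat | (f 0%N <= q)%N /\ forall n, (f n.+1 < q)%N}.

(* confluent x /\ xi (the last common vertex of pi(e,x) and pi(e,xi)) *)
Definition conf_end (q : nat) (x : vert q) (xi : endT q) : seq nat :=
  take (lcp (val x) (mkseq (sval xi) (size (val x)))) (val x).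

Definition hor (q : nat) (x : vert q) (xi : endT q) : int :=
  (wdist (val x) (conf_end x xi))%:Z - (size (conf_end x xi))%:Z.

Definition tc (q : nat) := (vert q + endT q)%type.
HB.instance Definition _ q := gen_eqMixin (tc q).
HB.instance Definition _ q := gen_choiceMixin (tc q).

(* the cone { w in T u dT : x lies on pi(e,w) } for a word x *)
Definition cone (q : nat) (x : seq nat) : set (tc q) :=
  fun w => match w with
           | inl v => x = take (size x) (val v)
           | inr xi => x = mkseq (sval xi) (size x)
           end.

(* subbase: the singletons of vertices (T is discrete) and the cones
   (a neighbourhood basis of each end) *)
Definition tc_idx := (bool * seq nat)%type.
HB.instance Definition _ := Choice.on tc_idx.
HB.instance Definition _ := isPointed.Build tc_idx (true, [::]).

Definition tc_subbase (q : nat) (i : tc_idx) : set (tc q) :=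
  if i.1 then (fun w => match w with inl v => val v = i.2 | inr _ => False end)
  else @cone q i.2.

HB.instance Definition _ q :=
  isSubBaseTopological.Build (tc q) [set: tc_idx] (@tc_subbase q).

(* Y is a compactification of X (X embedded via i as a discrete, open,
   dense subset of the compact Hausdorff space Y) in which every kernel
   function k(x,.) extends continuously (to kext x) and the extended kernels
   separate the boundary points Y \ i(X).  By the uniqueness statement in
   the definition, this says that Y (with i) IS the k-compactification,
   with extended kernel kext. *)
Definition kernel_compactification (R : realType) (X : Type)
    (Y : topologicalType) (i : X -> Y) (k : X -> X -> R) (kext : X -> Y -> R) :=
  [/\ compact [set: Y], hausdorff_space Y,
      injective i, (forall x, open [set i x]) &
      closure (range i) = [set: Y] ] /\
  [/\ (forall x y, kext x (i y) = k x y),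
      (forall x, continuous (kext x)) &
      (forall xi eta : Y, ~ range i xi -> ~ range i eta -> xi <> eta ->
         exists x, kext x xi <> kext x eta)].

Section Walk.
Variables (R : realType) (q : nat) (a : nat -> R).

Definition pd (d : nat) (x y : vert q) : R :=
  if d == 0%N then (x == y)%:R
  else if dist x y == d then (((q + 1) * q ^ d.-1)%N%:R)^-1 else 0.

Definition Pmat (x y : vert q) : R :=
  limn (fun n => \sum_(0 <= d < n) (a d * pd d x y)).

Fixpoint Pn (n : nat) (x y : vert q) : R :=
  match n with
  | 0%N => (x == y)%:R
  | n'.+1 => fine (\esum_(z in [set: vert q]) (Pmat x z * Pn n' z y)%:E)
  end.

Definition spec_rad : R :=
  limn_sup (fun n => Pn n (troot q) (troot q) `^ (n%:R^-1)).
Definition rconv : R := spec_rad^-1.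

Definition Green (x y : vert q) : R :=
  fine (\sum_(0 <= n <oo) ((Pn n x y * rconv ^+ n)%:E))%E.
Definition Ffun (x y : vert q) : R := Green x y / Green y y.
Definition Kmartin (x y : vert q) : R := Ffun x y / Ffun (troot q) y.

End Walk.

Definition phi (R : realType) (q n : nat) : R :=
  (1 + (q%:R - 1) / (q%:R + 1) * n%:R) * (q%:R `^ (- (n%:R / 2))).

Definition Hker (R : realType) (q : nat) (x y : vert q) : R :=
  phi R q (dist x y) / phi R q (vnorm y).

Definition bval (R : realType) (q : nat) (x : vert q) (xi : endT q) : R :=
  q%:R `^ (- ((hor x xi)%:~R / 2)).

Definition ext_kernel (R : realType) (q : nat) (k : vert q -> vert q -> R)
    (x : vert q) (w : tc q) : R :=
  match w with inl y => k x y | inr xi => bval R x xi end.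

(* Main.v *)
Require Import Defs.
From HB Require Import structures.
From mathcomp Require Import all_boot all_order all_algebra.
From mathcomp Require Import all_classical all_reals all_analysis.
From mathcomp Require Import finmap ring lra zify.
Import Order.TTheory GRing.Theory Num.Theory.
Import numFieldNormedType.Exports.
Local Open Scope classical_set_scope.
Local Open Scope ring_scope.
Set Implicit Arguments.
Unset Strict Implicit.
Unset Printing Implicit Defensive.

(* Every spherical mean is a function of the single averaging operator over
   neighbours, so p^(n)(x, y) = int lambda(t)^n phi_t(d(x, y)) dm(t), where the
   spherical function phi_t satisfies phi_0 = phi, lambda = sum_d a_d phi_t(d), and
   m is the Plancherel (Kesten-McKay) measure, with density proportional to
   sin^2 t / |1 - e^(2it) / q|^2 on [0, pi].  The function phi_t(n) is q^(-n/2)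
   times a nonnegative combination of cosines, whence |lambda| <= lambda(0) = rho;
   an odd and an even d in the support make t = 0 the only maximum of |lambda|.
   The powers lambda^n therefore concentrate at t = 0, which gives the ratio limit
   and the spectral radius.  For the Green function one writes
   rho - lambda = (1 - cos t) gap with gap > 0 smooth at 0; then G(x, y | r) is,
   up to the factor q^(-d(x,y)/2), a partial Fourier sum at 0 of a function that is
   continuous with a continuous difference quotient, and converges to a positive
   limit by the Riemann-Lebesgue lemma.  Hence both kernels are of the form
   g(d(x, y)) / g(|y|) with g(m + 1) / g(m) -> q^(-1/2), and they extend
   continuously to the ends by q^(-hor/2). *)

(** * Averages over [0, pi] and the Riemann-Lebesgue lemma *)

(** The local coordinate at the top of the spectrum is [1 - cos t], so [lambda] is never
    differentiated or Taylor expanded. Every quantity is linear in the cosines cos(kt), and division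
    by [1 - cos t] is carried out coefficient by coefficient: Fejer kernels, of size k^2, give
    [rho - lambda], and a second layer, of size k^4, gives the difference quotient of [gap]. The
    factor q^(-n/2) in the spherical functions absorbs this polynomial growth uniformly in t. Two
    obstacles shape the rest. Odd powers of [lambda] may be negative away from t = 0, so the n-th
    moments must be separated from an exponentially smaller tail before they can serve as
    denominators. At z = r the factor 1 / (1 - lambda / rho) is singular at t = 0; the sin^2 t of
    the Plancherel density cancels it exactly and leaves 1 + cos t, the factor that turns Chebyshev
    polynomials into Dirichlet kernels. *)

Section Average.
Variable R : realType.
Implicit Types f g : R -> R.

Definition avg f : R :=
  pi^-1 * (\int[@lebesgue_measure R]_(t in `[0, pi]) f t)%R.

Lemma continuous_integrable0pi f : continuous f ->
  (@lebesgue_measure R).-integrable `[0, pi] (EFin \o f).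
Proof.
move=> cf; apply: continuous_compact_integrable; first exact: segment_compact.
exact: continuous_subspaceT.
Qed.

Lemma avgD f g : continuous f -> continuous g ->
  avg (fun t => f t + g t) = avg f + avg g.
Proof.
move=> cf cg; rewrite /avg -mulrDr RintegralD//; exact: continuous_integrable0pi.
Qed.

Lemma avgB f g : continuous f -> continuous g ->
  avg (fun t => f t - g t) = avg f - avg g.
Proof.
move=> cf cg; rewrite /avg -mulrBr RintegralB//; exact: continuous_integrable0pi.
Qed.

Lemma avgZ r f : continuous f -> avg (fun t => r * f t) = r * avg f.
Proof.
move=> cf; rewrite /avg RintegralZl//; last exact: continuous_integrable0pi.
by rewrite mulrCA.
Qed.

Lemma avg_cst r : avg (fun=> r) = r.
Proof.
rewrite /avg Rintegral_cst//= lebesgue_measure_itv/= lte_fin pi_gt0/= subr0.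
by rewrite mulrC mulfK// gt_eqF// pi_gt0.
Qed.

Lemma le_avg f g : continuous f -> continuous g -> (forall t, f t <= g t) ->
  avg f <= avg g.
Proof.
move=> cf cg fg; rewrite /avg ler_pM2l ?invr_gt0 ?pi_gt0//.
by apply: le_Rintegral => //; exact: continuous_integrable0pi.
Qed.

Lemma avg_ge0 f : (forall t, 0 <= f t) -> 0 <= avg f.
Proof.
by move=> f0; rewrite mulr_ge0 ?invr_ge0 ?pi_ge0//; exact: Rintegral_ge0.
Qed.

Lemma avg_cos k : avg (fun t => cos (k%:R * t)) = (k == 0%N)%:R.
Proof.
case: k => [|k].
  rewrite [X in avg X](_ : _ = fun=> 1) ?avg_cst//.
  by apply/funext => t; rewrite mul0r cos0.
rewrite /avg /= /Rintegral.
pose F (t : R) := k.+1%:R^-1 * sin (k.+1%:R * t).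
have dF (t : R) : is_derive t 1 F (cos (k.+1%:R * t)).
  rewrite /F; apply: is_derive_eq.
  by rewrite /GRing.scale/= mulr1 mulrCA mulVf ?mulr1// pnatr_eq0.
rewrite (@continuous_FTC2 _ _ F) ?pi_gt0//; first last.
- by move=> t _; rewrite derive1E; exact: derive_val.
- split => [t _|/=|/=].
  + exact: @ex_derive _ _ _ _ _ _ _ (dF t).
  + apply: cvg_at_right_filter.
    by apply/differentiable_continuous/derivable1_diffP; exact: ex_derive.
  + apply: cvg_at_left_filter.
    by apply/differentiable_continuous/derivable1_diffP; exact: ex_derive.
- apply: continuous_subspaceT => t.
  by apply: continuous_comp; [exact: mulrl_continuous|exact: continuous_cos].
have sin0pi n : sin (n%:R * pi) = 0 :> R.
  elim: n => [|n IH]; first by rewrite mul0r sin0.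
  by rewrite -natr1 mulrDl mul1r sinDpi IH oppr0.
by rewrite /F /= sin0pi !mulr0 sin0 !mulr0 subrr mulr0.
Qed.

Lemma avg_gt0 f t0 : continuous f -> (forall t, 0 <= f t) ->
  0 < t0 < pi -> 0 < f t0 -> 0 < avg f.
Proof.
move=> cf f0 /andP[t0_gt0 t0_lt] ft0.
have [e e0 fe] : exists2 e : R, 0 < e & forall t, `|t0 - t| < e ->
    f t0 / 2 < f t /\ 0 < t < pi.
  have /nbhs_ballP[e e0 fe] : nbhs t0 [set t | f t0 / 2 < f t /\ 0 < t < pi].
    near=> t; split.
      by near: t; apply: (cvgr_gt (f t0)); [exact: cf|lra].
    apply/andP; split; near: t; [exact: lt_nbhsr|exact: lt_nbhsl].
  by exists e => // t te; exact: fe.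
have sub : `[t0 - e / 2, t0 + e / 2]%classic `<=` `[0, pi]%classic.
  move=> t /=; rewrite !in_itv/= => te.
  have /fe[_ /andP[? ?]] : `|t0 - t| < e.
    by rewrite ltr_norml; apply/andP; split; lra.
  by rewrite !ltW.
rewrite /avg mulr_gt0 ?invr_gt0 ?pi_gt0//.
apply: (@lt_le_trans _ _ (f t0 / 2 * e)); first by rewrite mulr_gt0//; lra.
have intf : (\int[@lebesgue_measure R]_(t in `[0%R, pi]) (f t)%:E \is a fin_num)%E.
  by apply: integrable_fin_num => //; exact: continuous_integrable0pi.
rewrite /Rintegral -lee_fin fineK//.
have /(@measurable_int _ _ _ _ _ _) mf := continuous_integrable0pi cf.
have le_int : (\int[@lebesgue_measure R]_(t in `[(t0 - e / 2)%R, (t0 + e / 2)%R]) (f t)%:E <=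
    \int[@lebesgue_measure R]_(t in `[0%R, pi]) (f t)%:E)%E.
  by apply: ge0_subset_integral => // t _; rewrite lee_fin.
apply: le_trans le_int.
have -> : (f t0 / 2 * e)%:E =
    (\int[@lebesgue_measure R]_(t in `[(t0 - e / 2)%R, (t0 + e / 2)%R]) (f t0 / 2)%:E)%E.
  rewrite integral_cst//= lebesgue_measure_itv/= lte_fin ifT; last lra.
  by rewrite -EFinD -EFinM; congr (_ * _)%:E; lra.
apply: ge0_le_integral => //=.
- by move=> t; rewrite lee_fin; lra.
- exact: measurable_funS mf.
- move=> t; rewrite -[_ \in _]/((t : R) \in `[_, _]) in_itv/= => te; rewrite lee_fin.
  suff /fe[/ltW] : `|t0 - t| < e by [].
  by rewrite ltr_norml; apply/andP; split; lra.
Unshelve. all: end_near. Qed.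

Lemma contD f g : continuous f -> continuous g -> continuous (fun t => f t + g t).
Proof. by move=> cf cg t; exact: cvgD (cf t) (cg t). Qed.

Lemma contN f : continuous f -> continuous (fun t => - f t).
Proof. by move=> cf t; exact: cvgN (cf t). Qed.

Lemma contM f g : continuous f -> continuous g -> continuous (fun t => f t * g t).
Proof. by move=> cf cg t; exact: cvgM (cf t) (cg t). Qed.

Lemma contX f n : continuous f -> continuous (fun t => f t ^+ n).
Proof.
move=> cf; elim: n => [|n IH]; first by move=> t; exact: cvg_cst.
rewrite (_ : (fun t => _) = fun t => f t * f t ^+ n); first exact: contM.
by apply/funext => t; rewrite exprS.
Qed.

Lemma contV f : (forall t, f t != 0) -> continuous f ->
  continuous (fun t => (f t)^-1).
Proof. by move=> f0 cf t; exact: cvgV (f0 t) (cf t). Qed.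

Lemma cont_cos k : continuous (fun t : R => cos (k%:R * t)).
Proof.
move=> t; apply: continuous_comp; first exact: mulrl_continuous.
exact: continuous_cos.
Qed.

Lemma cont_sum (I : Type) (r : seq I) (F : I -> R -> R) :
  (forall i, continuous (F i)) -> continuous (fun t => \sum_(i <- r) F i t).
Proof.
move=> cF; elim: r => [|i r IH].
  rewrite (_ : (fun t => _) = fun=> 0); first by move=> t; exact: cvg_cst.
  by apply/funext => t; rewrite big_nil.
rewrite (_ : (fun t => _) = fun t => F i t + \sum_(i <- r) F i t).
  exact: contD.
by apply/funext => t; rewrite big_cons.
Qed.

End Average.

Ltac cont := repeat lazymatch goal with
  | |- continuous (fun=> ?c) => by move=> ?; exact: cvg_cst
  | |- continuous (fun t => _ + _) => apply: contD
  | |- continuous (fun t => - _) => apply: contN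
  | |- continuous (fun t => _ * _) => apply: contM
  | |- continuous (fun t => _ ^+ _) => apply: contX
  | |- continuous (fun t => \sum_(i <- _) @?F t i) => apply: cont_sum => ?
  | |- continuous (fun t => cos (_%:R * t)) => exact: cont_cos
  | |- continuous (fun t => cos t) => exact: continuous_cos
  | |- _ => first [by [] | exact: continuous_cos]
  end.

Section RiemannLebesgue.
Variable R : realType.
Implicit Types f g : R -> R.

Lemma avg_sum (I : Type) (r : seq I) (F : I -> R -> R) :
  (forall i, continuous (F i)) ->
  avg (fun t => \sum_(i <- r) F i t) = \sum_(i <- r) avg (F i).
Proof.
move=> cF; elim: r => [|i r IH].
  rewrite big_nil -[RHS](avg_cst (0 : R)); congr avg.
  by apply/funext => t; rewrite big_nil.
rewrite big_cons -IH -avgD//; last exact: cont_sum.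
by congr avg; apply/funext => t; rewrite big_cons.
Qed.

Lemma ler_norm_avg f (c : R) : continuous f -> (forall t, `|f t| <= c) -> `|avg f| <= c.
Proof.
move=> cf fc; rewrite -(avg_cst c) ler_norml.
have ccst (d : R) : continuous (fun _ : R => d) by cont.
apply/andP; split; last first.
  by apply: le_avg => // t; have := fc t; rewrite ler_norml => /andP[].
rewrite avg_cst -[leLHS](avg_cst (- c)).
by apply: le_avg => // t; have := fc t; rewrite ler_norml => /andP[].
Qed.

Lemma ler_norm_avg_le f g : continuous f -> continuous g ->
  (forall t, `|f t| <= g t) -> `|avg f| <= avg g.
Proof.
move=> cf cg fg; rewrite ler_norml; apply/andP; split; last first.
  by apply: le_avg => // t; exact: le_trans (ler_norm _) (fg t).
rewrite -[avg g]mul1r -mulNr -avgZ//; apply: le_avg => // [|t]; first by cont.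
by rewrite mulN1r lerNl (le_trans _ (fg t))// -normrN ler_norm.
Qed.

Lemma cosM (x y : R) : cos x * cos y = (cos (x - y) + cos (x + y)) / 2.
Proof. rewrite cosB cosD; lra. Qed.

Lemma avg_cosM j k : avg (fun t : R => cos (j.+1%:R * t) * cos (k.+1%:R * t)) =
  (j == k)%:R / 2.
Proof.
wlog jk : j k / (k <= j)%N.
  move=> H; case/orP: (leq_total k j) => [/H//|/H]; rewrite eq_sym => <-.
  by congr avg; apply/funext => t; rewrite mulrC.
rewrite (_ : (fun t => _) = fun t => 2^-1 * cos ((j - k)%:R * t) +
    2^-1 * cos ((j + k).+2%:R * t)); last first.
  apply/funext => t; rewrite cosM natrB//.
  rewrite -addSn -addnS !natrD -mulrBl -mulrDl.
  rewrite (_ : j.+1%:R - k.+1%:R = j%:R - k%:R :> R); first lra.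
  by rewrite -!natr1; lra.
rewrite avgD; [|cont..].
rewrite !avgZ; [|cont..].
by rewrite !avg_cos mulr0 addr0 mulrC subn_eq0 eqn_leq jk andbT.
Qed.

Section Bessel.
Variable f : R -> R.
Hypothesis cf : continuous f.

Let c k := avg (fun t => f t * cos (k.+1%:R * t)).
Let S n t := \sum_(j < n) 2 * c j * cos (j.+1%:R * t).

Let cS n : continuous (S n).
Proof. rewrite /S; cont. Qed.

Let avgSe n m : (n <= m)%N -> avg (fun t => S n t * cos (m.+1%:R * t)) = 0.
Proof.
move=> nm; rewrite (_ : (fun t => _) = fun t => \sum_(j < n)
    2 * c j * (cos (j.+1%:R * t) * cos (m.+1%:R * t))); last first.
  by apply/funext => t; rewrite /S mulr_suml; apply: eq_bigr => i _; rewrite mulrA.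
rewrite avg_sum; last by move=> ?; cont.
rewrite big1// => i _; rewrite avgZ; last by cont.
by rewrite avg_cosM ltn_eqF ?mul0r ?mulr0// (leq_trans _ nm).
Qed.

(** The defect is the mean square of [f - S n]. The coefficients of [S n] are [2 * c j] because
    cos(jt) has mean square 1/2 for j >= 1; the constant mode is left out. *)
Lemma Bessel n : \sum_(j < n) 2 * c j ^+ 2 <= avg (fun t => f t ^+ 2).
Proof.
rewrite -subr_ge0.
suff -> : avg (fun t => f t ^+ 2) - \sum_(j < n) 2 * c j ^+ 2 =
    avg (fun t => (f t - S n t) ^+ 2) by apply: avg_ge0 => t; exact: sqr_ge0.
elim: n => [|n IH].
  rewrite big_ord0 subr0; congr avg; apply/funext => t.
  by rewrite /S big_ord0 subr0.
rewrite big_ord_recr/= opprD addrA IH.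
rewrite [in RHS](_ : (fun t => _) = fun t => (f t - S n t) ^+ 2 -
    4 * c n * (f t * cos (n.+1%:R * t)) + 4 * c n * (S n t * cos (n.+1%:R * t))
    + 4 * c n ^+ 2 * (cos (n.+1%:R * t) * cos (n.+1%:R * t))); last first.
  by apply/funext => t; rewrite /S big_ord_recr/= -/(S n t); ring.
have cSn := @cS n.
rewrite avgD; [|cont..].
rewrite avgD; [|cont..].
rewrite avgB; [|cont..].
rewrite !avgZ; [|cont..].
rewrite avgSe// avg_cosM eqxx -/(c n) mulr1n; by field.
Qed.

(** By [Bessel] the squared cosine coefficients of a continuous function are summable, hence tend to
    0. *)
Lemma Riemann_Lebesgue :
  (fun k => avg (fun t => f t * cos (k%:R * t))) @ \oo --> (0 : R).
Proof.
rewrite -cvg_shiftS/= -/c.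
have : (fun k => 2 * c k ^+ 2) @ \oo --> 0.
  apply: cvg_series_cvg_0; apply: nondecreasing_is_cvgn.
    by apply: nondecreasing_series => k _ _; rewrite mulr_ge0// sqr_ge0.
  exists (avg (fun t => f t ^+ 2)) => _ [n _ <-].
  by rewrite seriesEord/=; exact: Bessel.
move=> /cvgrPdist_lt h; apply/cvgrPdist_lt => e e0.
have e2 : 0 < e ^+ 2 by rewrite exprn_gt0.
near=> k; rewrite sub0r normrN -(ltr_pXn2r (n := 2))// ?nnegrE ?ltW//.
have : `|0 - 2 * c k ^+ 2| < e ^+ 2 by near: k; exact: h.
rewrite sub0r normrN ger0_norm; last by rewrite mulr_ge0// sqr_ge0.
rewrite real_normK ?num_real// => h'; have := sqr_ge0 (c k); lra.
Unshelve. all: end_near. Qed.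

End Bessel.
End RiemannLebesgue.

(** * Chebyshev, Dirichlet and Fejer kernels *)

Lemma nat_ind2 (P : nat -> Prop) :
  P 0%N -> P 1%N -> (forall n, P n -> P n.+1 -> P n.+2) -> forall n, P n.
Proof.
move=> P0 P1 PS n; suff [] : P n /\ P n.+1 by [].
by elim: n => [|n [Pn Pn1]]; split=> //; exact: PS.
Qed.

Section Alternate.
Variable R : realType.
Implicit Types g h : nat -> R.

(* For [g k = cos (k t)] this is the Chebyshev polynomial of the second kind:
   [alt g n] is the sum of the [g `|n - 2 j|] over [0 <= j <= n]. *)
Fixpoint alt g n : R :=
  if n is m.+1 then (if m is k.+1 then alt g k + 2 * g n else 2 * g 1%N)
  else g 0%N.

Lemma altSS g n : alt g n.+2 = alt g n + 2 * g n.+2. Proof. by []. Qed.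

Lemma altB g h n : alt (fun k => g k - h k) n = alt g n - alt h n.
Proof. by elim/nat_ind2: n => [||n IH _]; rewrite ?altSS ?IH /=; ring. Qed.

Lemma altZ r g n : alt (fun k => r * g k) n = r * alt g n.
Proof. by elim/nat_ind2: n => [||n IH _]; rewrite ?altSS ?IH /=; ring. Qed.

Lemma alt1 n : alt (fun=> 1) n = n.+1%:R.
Proof.
by elim/nat_ind2: n => [||n IH _]; rewrite ?altSS ?IH //= ?mulr1// -!natrD addn2.
Qed.

Lemma alt_ge0 g n : (forall k, 0 <= g k) -> 0 <= alt g n.
Proof.
move=> g0; elim/nat_ind2: n => [||n IH _]; rewrite ?altSS//= ?mulr_ge0//.
by rewrite addr_ge0// mulr_ge0.
Qed.

Lemma ler_norm_alt g n B : (forall k, (k <= n)%N -> `|g k| <= B) ->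
  `|alt g n| <= n.+1%:R * B.
Proof.
elim/nat_ind2: n => [||n IH _] gB.
- by rewrite mul1r; exact: gB.
- by rewrite normrM ger0_norm// ler_pM2l//; exact: gB.
- rewrite altSS; apply: le_trans (ler_normD _ _) _.
  have -> : n.+3%:R = n.+1%:R + 2 :> R by rewrite -natrD addn2.
  rewrite [leRHS]mulrDl; apply: lerD.
    by apply: IH => k kn; apply: gB; rewrite (leq_trans kn)// -addn2 leq_addr.
  by rewrite normrM ger0_norm// ler_pM2l//; exact: gB.
Qed.

(** Parity enters here and in [alt_even_ge]: the alternating sum meets index 1 twice when n is odd,
    and index 0 once when n is even. *)
Lemma alt_odd_ge g n : (forall k, 0 <= g k) -> odd n -> 2 * g 1%N <= alt g n.
Proof.
move=> g0; elim/nat_ind2: n => [||n IH _]//= on.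
rewrite -[_ + _]/(alt g n.+2) altSS (le_trans (IH _))//; first by rewrite negbK in on.
by rewrite lerDl mulr_ge0.
Qed.

Lemma alt_even_ge g n : (forall k, 0 <= g k) -> ~~ odd n -> g 0%N <= alt g n.
Proof.
move=> g0; elim/nat_ind2: n => [||n IH _]//= on.
rewrite -[_ + _]/(alt g n.+2) altSS (le_trans (IH _))//; first by rewrite !negbK in on.
by rewrite lerDl mulr_ge0.
Qed.

End Alternate.

Section CosineKernels.
Variable R : realType.
Implicit Types t : R.

Definition cosn t k : R := cos (k%:R * t).

Lemma cosn0 t : cosn t 0 = 1. Proof. by rewrite /cosn mul0r cos0. Qed.

Lemma cosn1 t : cosn t 1 = cos t. Proof. by rewrite /cosn mul1r. Qed.

Lemma cosnSS t k : cosn t k.+2 = 2 * cos t * cosn t k.+1 - cosn t k.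
Proof.
rewrite -mulrA /cosn cosM.
rewrite (_ : t - k.+1%:R * t = - (k%:R * t)); last by rewrite -natr1; ring.
rewrite (_ : t + k.+1%:R * t = k.+2%:R * t); last by rewrite -!natr1; ring.
by rewrite cosN; field.
Qed.

Lemma cosn_le1 t k : `|cosn t k| <= 1. Proof. exact: cos_max. Qed.

Lemma cosn_mul2 t k :
  2 * cosn t 2 * cosn t k.+2 = cosn t k + cosn t k.+4.
Proof. by rewrite !cosnSS cosn0 cosn1; ring. Qed.

Lemma cosn2 t : cosn t 2 = 2 * cos t ^+ 2 - 1.
Proof. by rewrite cosnSS cosn0 cosn1; ring. Qed.

Lemma altcosSS t n :
  alt (cosn t) n.+2 = 2 * cos t * alt (cosn t) n.+1 - alt (cosn t) n.
Proof.
elim/nat_ind2: n => [||n IH _].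
- by rewrite altSS /= !cosnSS cosn0 cosn1; ring.
- by rewrite !altSS /= !cosnSS cosn0 cosn1; ring.
- by rewrite [LHS]altSS {1}IH (altSS _ n.+1) [alt _ n.+2]altSS !cosnSS; ring.
Qed.

(** As [alt (cosn t) n] is sin((n+1)t) / sin t, this is the product formula for 2 sin t sin((n+1)t).
    It turns the density times a spherical function into a few cosines. *)
Lemma sin2_altcos t n :
  2 * (1 - cos t ^+ 2) * alt (cosn t) n = cosn t n - cosn t n.+2.
Proof.
elim/nat_ind2: n => [||n IH _].
- by rewrite /= !cosnSS cosn0 cosn1; ring.
- by rewrite /= !cosnSS cosn0 cosn1; ring.
- by rewrite altSS mulrDr IH !cosnSS; ring.
Qed.

Definition dirichlet t i : R := 1 + 2 * \sum_(j < i) cosn t j.+1.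
Definition fejer t m : R := \sum_(i < m) dirichlet t i.

Lemma dirichletS t i : dirichlet t i.+1 = dirichlet t i + 2 * cosn t i.+1.
Proof. by rewrite /dirichlet big_ord_recr/=; ring. Qed.

Lemma dirichletE t i : (1 - cos t) * dirichlet t i = cosn t i - cosn t i.+1.
Proof.
elim: i => [|i IH].
  by rewrite /dirichlet big_ord0 cosn0 cosn1; ring.
by rewrite dirichletS mulrDr IH !cosnSS; ring.
Qed.

Lemma fejerE t m : (1 - cos t) * fejer t m = 1 - cosn t m.
Proof.
elim: m => [|m IH]; rewrite /fejer.
  by rewrite big_ord0 cosn0; ring.
by rewrite big_ord_recr/= mulrDr -/(fejer t m) IH dirichletE; ring.
Qed.

(** The second division by [1 - cos t]. The kernel [fejer t m] is (1 - cos(mt)) / (1 - cos t), with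
    value m^2 at t = 0, and [fejer2 t m] is the quotient of m^2 - [fejer t m]. Written as sums of
    cosines, the quotients keep a meaning at t = 0. *)
Definition dirichlet2 t i : R := 2 * \sum_(j < i) fejer t j.+1.
Definition fejer2 t m : R := \sum_(i < m) dirichlet2 t i.

Lemma dirichlet2E t i : (1 - cos t) * dirichlet2 t i = i.*2.+1%:R - dirichlet t i.
Proof.
elim: i => [|i IH]; rewrite /dirichlet2.
  by rewrite /dirichlet !big_ord0 !mulr0 addr0 subrr.
rewrite big_ord_recr/= mulrDr mulrDr -/(dirichlet2 t i) IH mulrCA fejerE.
rewrite dirichletS (_ : i.+1.*2.+1%:R = i.*2.+1%:R + 2 :> R); first by ring.
by rewrite -natrD addn2.
Qed.

Lemma fejer2E t m : (1 - cos t) * fejer2 t m = (m ^ 2)%:R - fejer t m.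
Proof.
elim: m => [|m IH]; rewrite /fejer2.
  by rewrite /fejer !big_ord0; ring.
rewrite big_ord_recr/= mulrDr -/(fejer2 t m) IH dirichlet2E.
rewrite /fejer big_ord_recr/=.
rewrite (_ : m.+1 ^ 2 = m ^ 2 + m.*2.+1)%N ?natrD; first by ring.
by rewrite -!mulnn -addnn mulSn mulnS; lia.
Qed.

Lemma ler_norm_sum_ord n (f : 'I_n -> R) B : (forall i, `|f i| <= B) ->
  `|\sum_(i < n) f i| <= n%:R * B.
Proof.
move=> fB; rewrite (le_trans (ler_norm_sum _ _ _))//.
rewrite (le_trans (ler_sum _ (fun i _ => fB i)))//.
by rewrite sumr_const card_ord -[_ *+ _]mulr_natl.
Qed.

Lemma ler_norm_dirichlet t i : `|dirichlet t i| <= i.*2.+1%:R.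
Proof.
rewrite (le_trans (ler_normD _ _))// normr1.
rewrite -(@natr1 _ i.*2) addrC lerD2r.
rewrite normrM ger0_norm// -mul2n natrM ler_pM2l//.
by rewrite -[leRHS]mulr1; apply: ler_norm_sum_ord => j; exact: cosn_le1.
Qed.

Lemma ler_norm_fejer t m : `|fejer t m| <= (m ^ 2)%:R.
Proof.
elim: m => [|m IH]; rewrite /fejer.
  by rewrite big_ord0 normr0.
rewrite big_ord_recr/= (le_trans (ler_normD _ _))//.
rewrite (_ : m.+1 ^ 2 = m ^ 2 + m.*2.+1)%N ?natrD ?lerD//.
  exact: ler_norm_dirichlet.
by rewrite -!mulnn -addnn mulSn mulnS; lia.
Qed.

Lemma ler_norm_dirichlet2 t i : `|dirichlet2 t i| <= (2 * i ^ 3)%:R.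
Proof.
rewrite normrM ger0_norm// natrM ler_pM2l// expnS natrM.
apply: ler_norm_sum_ord => j; rewrite (le_trans (ler_norm_fejer _ _))//.
by rewrite ler_nat leq_exp2r.
Qed.

Lemma ler_norm_fejer2 t m : `|fejer2 t m| <= (2 * m ^ 4)%:R.
Proof.
rewrite [(m ^ 4)%N]expnS mulnCA natrM; apply: ler_norm_sum_ord => j.
rewrite (le_trans (ler_norm_dirichlet2 _ _))// ler_nat leq_mul2l leq_exp2r//.
by rewrite ltnW ?orbT.
Qed.

Lemma cosn_eq1 t k : cos t = 1 -> cosn t k = 1.
Proof.
move=> t1; elim/nat_ind2: k => [||k IH IH1]; rewrite ?cosn0 ?cosn1//.
by rewrite cosnSS IH IH1 t1; ring.
Qed.

Lemma fejer_ge0 t m : 0 <= fejer t m.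
Proof.
have [t1|t1] := eqVneq (cos t) 1.
  apply: sumr_ge0 => i _; rewrite addr_ge0// mulr_ge0//.
  by apply: sumr_ge0 => j _; rewrite cosn_eq1.
have ct : 0 < 1 - cos t by rewrite subr_gt0 lt_neqAle t1 cos_le1.
rewrite -(pmulr_rge0 _ ct) fejerE subr_ge0.
exact: cos_le1.
Qed.

Lemma fejer1 t : fejer t 1 = 1.
Proof. by rewrite /fejer big_ord1 /dirichlet big_ord0 mulr0 addr0. Qed.

Lemma continuous_cosn k : continuous (fun t => cosn t k).
Proof. exact: cont_cos. Qed.

Lemma continuous_fejer m : continuous (fun t => fejer t m).
Proof. by rewrite /fejer /dirichlet /cosn; cont. Qed.

Lemma continuous_fejer2 m : continuous (fun t => fejer2 t m).
Proof. by rewrite /fejer2 /dirichlet2 /fejer /dirichlet /cosn; cont. Qed.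

Lemma continuous_dirichlet i : continuous (fun t => dirichlet t i).
Proof. by rewrite /dirichlet /cosn; cont. Qed.

Lemma avg_dirichlet i : avg (fun t => dirichlet t i) = 1.
Proof.
rewrite /dirichlet /cosn avgD; [|cont..].
rewrite avgZ; last by cont.
rewrite avg_sum; last by move=> ?; cont.
by rewrite avg_cst big1 ?mulr0 ?addr0// => j _; exact: avg_cos.
Qed.

Lemma avg_fejer m : avg (fun t => fejer t m) = m%:R.
Proof.
rewrite /fejer avg_sum; last exact: continuous_dirichlet.
rewrite -[in RHS](card_ord m) -sumr_const; apply: eq_bigr => i _.
exact: avg_dirichlet.
Qed.

(** In half angles, both sides are 2 sin((k+1)t) cos(t/2) / sin(t/2). Through this identity the
    Green function becomes a pair of Fourier partial sums at 0. *)
Lemma altcos_dirichlet t k :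
  2 * ((1 + cos t) * alt (cosn t) k) = dirichlet t k + dirichlet t k.+1.
Proof.
elim/nat_ind2 : k => [||k IH _].
- by rewrite dirichletS /dirichlet big_ord0 /= cosn0 cosn1; ring.
- by rewrite !dirichletS /dirichlet big_ord0 /= !cosnSS cosn0 cosn1; ring.
- by rewrite altSS mulrDr mulrDr IH !dirichletS !cosnSS; ring.
Qed.

End CosineKernels.

(** * Spherical functions *)

Section SphericalCoefficients.
Variables (R : realType) (q : nat).
Hypothesis q2 : (2 <= q)%N.
Implicit Types (g h : nat -> R) (t : R).

Definition sq : R := Num.sqrt q%:R.

(** At g = cos(k t) this is the classical formula for spherical functions by Chebyshev polynomials
    of both kinds. It is kept linear in an arbitrary sequence [g] so that it can also be fed 1,
    [fejer t] and [fejer2 t]; its coefficients are nonnegative with total [phi R q n]. *)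
Definition Phi n g : R :=
  sq^-1 ^+ n * (((q%:R - 1) * alt g n + 2 * g n) / (q%:R + 1)).

Definition sph n t : R := Phi n (cosn t).

Let q1 : 1 < q%:R :> R. Proof. by rewrite ltr1n. Qed.
Let q_gt0 : 0 < q%:R :> R. Proof. exact: lt_trans ltr01 q1. Qed.

Let qB1_ge0 : 0 <= q%:R - 1 :> R. Proof. by rewrite subr_ge0 ltW. Qed.
Let qD1_neq0 : q%:R + 1 != 0 :> R. Proof. by rewrite gt_eqF. Qed.

Lemma sq_gt0 : 0 < sq. Proof. by rewrite sqrtr_gt0. Qed.

Let sqVX_ge0 n : 0 <= sq^-1 ^+ n.
Proof. by rewrite exprn_ge0 ?invr_ge0 ?ltW ?sq_gt0. Qed.

Lemma sq_sqr : sq ^+ 2 = q%:R. Proof. by rewrite sqr_sqrtr// ltW. Qed.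

Lemma sq_gt1 : 1 < sq.
Proof. by rewrite -sqrtr1 ltr_sqrt. Qed.

Lemma PhiB g h n : Phi n (fun k => g k - h k) = Phi n g - Phi n h.
Proof. by rewrite /Phi altB; ring. Qed.

Lemma PhiZ r g n : Phi n (fun k => r * g k) = r * Phi n g.
Proof. by rewrite /Phi altZ; ring. Qed.

Lemma Phi_ge0 g n : (forall k, 0 <= g k) -> 0 <= Phi n g.
Proof.
by move=> g0; rewrite !mulr_ge0 ?addr_ge0 ?mulr_ge0 ?alt_ge0.
Qed.

Lemma PhiE1 n : Phi n (fun=> 1) = phi R q n.
Proof.
rewrite /Phi /phi alt1 mulrC; congr (_ * _).
  by rewrite -natr1; field.
rewrite powRN -mulrC powRrM powR12_sqrt ?ler0n// powR_mulrn ?sqrtr_ge0//.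
by rewrite exprVn.
Qed.

Lemma phi_gt0 n : 0 < phi R q n.
Proof.
by rewrite /phi mulr_gt0 ?powR_gt0// ltr_pwDl// !mulr_ge0.
Qed.

Lemma ler_norm_Phi g n B : (forall k, (k <= n)%N -> `|g k| <= B) ->
  `|Phi n g| <= B * phi R q n.
Proof.
move=> gB; rewrite -PhiE1 /Phi alt1 normrM ger0_norm//.
rewrite [leRHS]mulrCA ler_wpM2l// mulrA normrM [X in _ * X]ger0_norm//.
rewrite ler_wpM2r// (le_trans (ler_normD _ _))// [leRHS]mulrDr lerD//; last first.
  by rewrite normrM ger0_norm// mulr1 mulrC ler_wpM2r//; exact: gB.
rewrite normrM ger0_norm// mulrCA ler_wpM2l// mulrC.
exact: ler_norm_alt.
Qed.

Lemma sph0 t : sph 0 t = 1.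
Proof. by rewrite /sph /Phi expr0 mul1r /= cosn0; field. Qed.

Lemma sph1 t : (q%:R + 1) * sph 1 t = 2 * sq * cos t.
Proof.
rewrite /sph /Phi /= cosn1 expr1.
have -> : q%:R = sq ^+ 2 by rewrite sq_sqr.
by field; rewrite sq_sqr qD1_neq0 gt_eqF ?sq_gt0.
Qed.

Lemma sphSS t n : q%:R * sph n.+2 t = 2 * sq * cos t * sph n.+1 t - sph n t.
Proof.
rewrite /sph /Phi altcosSS cosnSS !exprS.
have -> : q%:R = sq ^+ 2 by rewrite sq_sqr.
by field; rewrite sq_sqr qD1_neq0 gt_eqF ?sq_gt0.
Qed.

Lemma sph_le n t : `|sph n t| <= phi R q n.
Proof.
by rewrite -[leRHS]mul1r; apply: ler_norm_Phi => k _; exact: cosn_le1.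
Qed.

Lemma continuous_Phi n (f : R -> nat -> R) : (forall k, continuous (f^~ k)) ->
  continuous (fun t => Phi n (f t)).
Proof.
move=> cf; rewrite /Phi; apply: contM; first by cont.
apply: contM; last by cont.
apply: contD; last by cont.
apply: contM; first by cont.
elim/nat_ind2 : n => [||n IH _] /=; cont.
Qed.

Lemma Phi_odd_ge g n : (forall k, 0 <= g k) -> odd n ->
  sq^-1 ^+ n * ((q%:R - 1) * (2 * g 1%N) / (q%:R + 1)) <= Phi n g.
Proof.
move=> g0 on; rewrite ler_wpM2l// ler_wpM2r//.
by rewrite -[leLHS]addr0 lerD ?mulr_ge0// ler_wpM2l ?alt_odd_ge.
Qed.

Lemma Phi_even_ge g n : (forall k, 0 <= g k) -> ~~ odd n ->
  sq^-1 ^+ n * ((q%:R - 1) * g 0%N / (q%:R + 1)) <= Phi n g.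
Proof.
move=> g0 on; rewrite ler_wpM2l// ler_wpM2r//.
by rewrite -[leLHS]addr0 lerD ?mulr_ge0// ler_wpM2l ?alt_even_ge.
Qed.

Lemma phi_decay : exists B, forall n, n.+1%:R ^+ 4 * phi R q n <= B.
Proof.
(* With y^5 = q^(-1/2), the factor q^(-n/2) splits into five copies of y^n: four absorb (n+1)^4 and
   the fifth the linear factor of [phi]. *)
pose y : R := q%:R `^ (- 10^-1).
have y0 : 0 < y by rewrite powR_gt0.
have y5 : y ^+ 5 = sq^-1.
  rewrite -powR_mulrn ?ltW// -powRrM /sq -[Num.sqrt _]powR12_sqrt ?ler0n// -powRN.
  by congr (_ `^ _); field.
have y1 : y < 1.
  rewrite ltNge; apply/negP => /(exprn_ege1 5).
  by rewrite y5 leNgt invf_lt1 ?sq_gt0// sq_gt1.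
(* Each of the n+1 terms of the geometric sum 1 + y + ... + y^n is at least y^n. *)
have lin n : n.+1%:R * y ^+ n <= (1 - y)^-1.
  rewrite -[leRHS]mul1r ler_pdivlMr ?subr_gt0//.
  have : 1 - y ^+ n.+1 <= 1 by rewrite gerBl exprn_ge0// ltW.
  apply: le_trans; have -> : 1 - y ^+ n.+1 = (1 - y) * \sum_(i < n.+1) y ^+ i.
    by rewrite -[LHS]opprB subrX1 -mulNr opprB.
  rewrite mulrC ler_pM2l ?subr_gt0//.
  rewrite -[X in X%:R * _](card_ord n.+1) mulr_natl -sumr_const; apply: ler_sum => i _.
  by rewrite ler_wiXn2l// ?ltW// -ltnS.
exists (2 * (1 - y)^-1 ^+ 5) => n.
have sqn : sq^-1 ^+ n = (y ^+ n) ^+ 5 by rewrite -y5 exprAC.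
rewrite -PhiE1 /Phi alt1 sqn mulr1.
have -> : n.+1%:R ^+ 4 * ((y ^+ n) ^+ 5 * (((q%:R - 1) * n.+1%:R + 2) / (q%:R + 1))) =
  (n.+1%:R * y ^+ n) ^+ 5 * (((q%:R - 1) + 2 / n.+1%:R) / (q%:R + 1)).
  have /negbT := pnatr_eq0 R n.+1; move: n.+1%:R => m m0.
  by field; rewrite qD1_neq0 m0.
rewrite [leRHS]mulrC ler_pM//.
- by rewrite exprn_ge0// mulr_ge0// exprn_ge0// ltW.
- by rewrite mulr_ge0// addr_ge0// divr_ge0.
- by rewrite ler_pXn2r// ?nnegrE ?invr_ge0 ?mulr_ge0 ?exprn_ge0 ?ltW ?subr_gt0.
- rewrite ler_pdivrMr//.
  have : 2 / n.+1%:R <= 2 :> R by rewrite ler_pdivrMr// ler_peMr// ler1n.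
  by move: (2 / n.+1%:R) qB1_ge0 => z; move: (q%:R : R) => Q; lra.
Qed.

End SphericalCoefficients.

(** * Mixtures of spherical functions *)

Section Limits.
Variable R : realType.

Lemma cvgn_le (u : nat -> R) l b N : u @ \oo --> l ->
  (forall n, (N <= n)%N -> u n <= b) -> l <= b.
Proof.
move=> ul ub; rewrite -(cvg_lim _ ul)//; apply: limr_le; first by apply/cvg_ex; exists l.
by near=> n; apply: ub; near: n; exact: nbhs_infty_ge.
Unshelve. all: end_near. Qed.

Lemma cvgn_ge (u : nat -> R) l b N : u @ \oo --> l ->
  (forall n, (N <= n)%N -> b <= u n) -> b <= l.
Proof.
move=> ul ub; rewrite -(cvg_lim _ ul)//; apply: limr_ge; first by apply/cvg_ex; exists l.
by near=> n; apply: ub; near: n; exact: nbhs_infty_ge.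
Unshelve. all: end_near. Qed.

Lemma cvgn_dominated (u e : nat -> R) (l : R) : (forall n, `|l - u n| <= e n) ->
  e @ \oo --> (0 : R) -> u @ \oo --> l.
Proof.
move=> ue e0; apply/cvgrPdist_le => eps eps0; near=> n.
apply: le_trans (ue n) _; apply: (le_trans (ler_norm _)).
have : `|0 - e n| <= eps by near: n; move/cvgrPdist_le : e0; exact.
by rewrite sub0r normrN.
Unshelve. all: end_near. Qed.

Lemma uniform_limit_continuous (f : R -> R) (f_ : nat -> R -> R) (e : nat -> R) :
  (forall n, continuous (f_ n)) -> (forall n t, `|f t - f_ n t| <= e n) ->
  e @ \oo --> (0 : R) -> continuous f.
Proof.
move=> cf fe e0 t; apply/cvgrPdist_lt => eps eps0.
have e3 : 0 < eps / 3 by rewrite divr_gt0.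
have /cvgrPdist_lt/(_ _ e3)[N _ eN] := e0.
have {}eN : e N < eps / 3.
  by have := eN N (leqnn _); rewrite /= sub0r normrN; apply: le_lt_trans; exact: ler_norm.
near=> s.
have h1 := fe N t; have h2 := fe N s.
have h3 : `|f_ N t - f_ N s| < eps / 3.
  by near: s; have /cvgrPdist_lt := cf N t; exact.
rewrite (_ : f t - f s = (f t - f_ N t) + (f_ N t - f_ N s) - (f s - f_ N s)); last ring.
rewrite (le_lt_trans (ler_normB _ _))// (le_lt_trans (lerD (ler_normD _ _) (lexx _)))//.
lra.
Unshelve. all: end_near. Qed.

Lemma avg_uniform_cvg (f : R -> R) (f_ : nat -> R -> R) (e : nat -> R) :
  (forall n, continuous (f_ n)) -> (forall n t, `|f t - f_ n t| <= e n) ->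
  e @ \oo --> (0 : R) -> avg (f_ n) @[n --> \oo] --> avg f.
Proof.
move=> cf fe e0; have cF := uniform_limit_continuous cf fe e0.
apply: (cvgn_dominated _ e0) => n; rewrite -avgB//.
by apply: ler_norm_avg => [|t]; [cont|exact: fe].
Qed.

End Limits.

Section Mixture.
Variables (R : realType) (q : nat) (a : nat -> R).
Hypothesis q2 : (2 <= q)%N.
Hypothesis a_ge0 : forall d, 0 <= a d.
Hypothesis a_sum : (fun n => \sum_(0 <= d < n) a d) @ \oo --> (1 : R).
Implicit Types (g h : nat -> R) (t : R).

(** Degree 4 is the growth of [fejer2], the largest sequence to which [Lam] is applied. *)
Definition tame (C : R) g := forall k, `|g k| <= C * k.+1%:R ^+ 4.

Definition Lam_upto N g : R := \sum_(0 <= d < N) a d * Phi q d g.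
Definition Lam g : R := limn (fun N => Lam_upto N g).
Definition atail N : R := 1 - \sum_(0 <= d < N) a d.

Lemma atail_cvg : atail @ \oo --> (0 : R).
Proof.
by rewrite -[0 in X in _ --> X](subrr (1 : R)); apply: cvgB => //; exact: cvg_cst.
Qed.

Lemma sum_a_le_atail N M : \sum_(N <= d < M) a d <= atail N.
Proof.
rewrite /atail lerBrDl; case: (leqP N M) => NM; last first.
  rewrite (big_geq (ltnW NM)) addr0; apply: (cvgn_ge (N := N) a_sum) => n Nn.
  by rewrite (big_cat_nat (leq0n N) Nn)//= lerDl sumr_ge0.
rewrite -big_cat_nat//=; apply: (cvgn_ge (N := M) a_sum) => n Mn.
by rewrite [leRHS](big_cat_nat (leq0n M) Mn)//= lerDl sumr_ge0.
Qed.

Lemma Phi_tame : exists2 B, 0 < B &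
  forall C g n, tame C g -> `|Phi q n g| <= C * B.
Proof.
have [B0 HB] := phi_decay R q2.
exists (`|B0| + 1); first by rewrite ltr_wpDl.
move=> C g n gC.
have C0 : 0 <= C.
  by have := gC 0%N; rewrite expr1n mulr1; apply: le_trans.
apply: (@le_trans _ _ (C * n.+1%:R ^+ 4 * phi R q n)).
  apply: ler_norm_Phi => // k kn; rewrite (le_trans (gC k))// ler_wpM2l//.
  by rewrite lerXn2r ?nnegrE// ler_nat.
rewrite -mulrA ler_wpM2l// (le_trans (HB n))//.
by rewrite (le_trans (ler_norm _))// lerDl.
Qed.

Lemma Lam_cvg C g : tame C g -> (fun N => Lam_upto N g) @ \oo --> Lam g.
Proof.
have [B B0 HB] := Phi_tame; move=> gC.
apply: (@normed_cvg _ _ (fun d => a d * Phi q d g)).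
apply: (@series_le_cvg _ _ (fun d => C * B * a d)) => [n|n|n|].
- exact: normr_ge0.
- by rewrite mulr_ge0// (le_trans _ (HB _ _ 0%N gC)).
- by rewrite /= normrM ger0_norm// mulrC ler_wpM2r// HB.
- apply/cvg_ex; exists (C * B * 1).
  rewrite (_ : series _ = fun n => C * B * \sum_(0 <= d < n) a d).
    by apply: cvgM => //; exact: cvg_cst.
  by apply/funext => n; rewrite /series/= mulr_sumr.
Qed.

(** The error depends on [g] only through [C]. For a family [g t] that is tame with one constant
    this is uniform convergence in t, the source of continuity and of the interchange with [avg]. *)
Lemma Lam_upto_tail : exists2 B, 0 < B & forall C g N, tame C g ->
  `|Lam g - Lam_upto N g| <= C * B * atail N.
Proof.
have [B B0 HB] := Phi_tame; exists B => // C g N gC.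
have hc : (fun M => `|Lam_upto M g - Lam_upto N g|) @ \oo --> `|Lam g - Lam_upto N g|.
  by apply: cvg_norm; apply: cvgB; [exact: Lam_cvg gC|exact: cvg_cst].
apply: (cvgn_le (N := N) hc) => M NM.
rewrite /Lam_upto (big_cat_nat (leq0n N) NM)/= [X in `|X|]addrAC subrr add0r.
apply: (@le_trans _ _ (\sum_(N <= d < M) C * B * a d)).
  rewrite (le_trans (ler_norm_sum _ _ _))//; apply: ler_sum => d _.
  by rewrite normrM ger0_norm// mulrC ler_wpM2r// HB.
rewrite -mulr_sumr ler_wpM2l ?sum_a_le_atail//.
by rewrite (le_trans _ (HB _ _ 0%N gC)).
Qed.

Lemma LamB C g h : tame C g -> tame C h -> Lam (fun k => g k - h k) = Lam g - Lam h.
Proof.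
move=> gC hC; apply: cvg_lim => //.
rewrite (_ : (fun N => _) = fun N => Lam_upto N g - Lam_upto N h).
  by apply: cvgB; [exact: Lam_cvg gC|exact: Lam_cvg hC].
apply/funext => N; rewrite /Lam_upto -sumrB; apply: eq_bigr => d _.
by rewrite PhiB; ring.
Qed.

Lemma LamZ C r g : tame C g -> Lam (fun k => r * g k) = r * Lam g.
Proof.
move=> gC; apply: cvg_lim => //.
rewrite (_ : (fun N => _) = fun N => r * Lam_upto N g).
  by apply: cvgM; [exact: cvg_cst|exact: Lam_cvg gC].
apply/funext => N; rewrite /Lam_upto mulr_sumr; apply: eq_bigr => d _.
by rewrite PhiZ; ring.
Qed.

Lemma Lam_ge C g n : tame C g -> (forall k, 0 <= g k) -> a n * Phi q n g <= Lam g.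
Proof.
move=> gC g0; apply: (cvgn_ge (N := n.+1) (Lam_cvg gC)) => N nN.
rewrite /Lam_upto (big_cat_nat (leq0n n.+1) nN)/= big_nat_recr//= -addrA addrCA lerDl.
by rewrite addr_ge0// sumr_ge0// => d _; rewrite mulr_ge0// Phi_ge0.
Qed.

Lemma continuous_Lam C (g : R -> nat -> R) :
  (forall k, continuous (fun t => g t k)) -> (forall t, tame C (g t)) ->
  continuous (fun t => Lam (g t)).
Proof.
move=> cg gC; have [B B0 HB] := Lam_upto_tail.
apply: (uniform_limit_continuous (f_ := fun N t => Lam_upto N (g t))
  (e := fun N => C * B * atail N)).
- move=> N; rewrite /Lam_upto; apply: cont_sum => d; apply: contM; first by cont.
  exact: continuous_Phi.
- by move=> N t; exact: HB.
- by rewrite -[0 in X in _ --> X](mulr0 (C * B)); apply: cvgM; [exact: cvg_cst|exact: atail_cvg].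
Qed.

(** One functional at four sequences: the eigenvalue of P, its value at t = 0, and the first and
    second quotients by [1 - cos t]. *)
Definition lam t : R := Lam (cosn t).
Definition rho : R := Lam (fun=> 1).
Definition gap t : R := Lam (fejer t).
Definition gap2 t : R := Lam (fejer2 t).

Lemma tame_natrX C j g : (j <= 4)%N -> 0 <= C ->
  (forall k, `|g k| <= C * (k ^ j)%:R) -> tame C g.
Proof.
move=> j4 C0 gC k; rewrite (le_trans (gC k))// ler_wpM2l// -natrX ler_nat.
rewrite (@leq_trans (k.+1 ^ j))// ?leq_pexp2l//.
by case: j j4 gC => // j _ _; rewrite leq_exp2r.
Qed.

End Mixture.

(** * The spectral gap and the Plancherel density *)

Section Gap.
Variables (R : realType) (q : nat) (a : nat -> R).
Hypothesis q2 : (2 <= q)%N.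
Hypothesis a_ge0 : forall d, 0 <= a d.
Hypothesis a_sum : (fun n => \sum_(0 <= d < n) a d) @ \oo --> (1 : R).
Hypothesis a_odd : exists d, odd d /\ 0 < a d.
Hypothesis a_even : exists d, ~~ odd d /\ 0 < a d.
Implicit Types (g h : nat -> R) (t : R).
Local Notation Lam := (Lam q a).
Local Notation lam := (lam q a).
Local Notation rho := (rho q a).
Local Notation gap := (gap q a).
Local Notation gap2 := (gap2 q a).

Let q1 : 1 < q%:R :> R. Proof. by rewrite ltr1n. Qed.

Lemma tame_cosn t : tame 1 (cosn t).
Proof. by apply: (@tame_natrX _ _ 0) => // k; rewrite expn0 mul1r; exact: cosn_le1. Qed.

Lemma tame_cst1 : tame 1 (fun=> 1 : R).
Proof. by apply: (@tame_natrX _ _ 0) => // k; rewrite expn0 mul1r normr1. Qed.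

Lemma tame_fejer t : tame 1 (fejer t).
Proof. by apply: (@tame_natrX _ _ 2) => // k; rewrite mul1r; exact: ler_norm_fejer. Qed.

Lemma tame_fejer2 t : tame 2 (fejer2 t).
Proof.
by apply: (@tame_natrX _ _ 4) => // k; rewrite -natrM; exact: ler_norm_fejer2.
Qed.

Lemma Lam_bounded : exists2 B, 0 < B & forall C g, tame C g -> `|Lam g| <= C * B.
Proof.
have [B B0 HB] := Lam_upto_tail q2 a_ge0 a_sum; exists B => // C g gC.
have := HB C g 0%N gC.
by rewrite /Lam_upto /atail !big_geq// !subr0 mulr1.
Qed.

Lemma rhoB_lam t : rho - lam t = (1 - cos t) * gap t.
Proof.
rewrite -(LamB q2 a_ge0 a_sum tame_cst1 (tame_cosn t)).
rewrite -(LamZ q2 a_ge0 a_sum _ (tame_fejer t)).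
by congr (Lam _); apply/funext => k; rewrite fejerE.
Qed.

Lemma gap0B_gap t : gap 0 - gap t = (1 - cos t) * gap2 t.
Proof.
rewrite -(LamB q2 a_ge0 a_sum (tame_fejer 0) (tame_fejer t)).
rewrite -(LamZ q2 a_ge0 a_sum _ (tame_fejer2 t)).
congr (Lam _); apply/funext => k; rewrite fejer2E.
(* At t = 0 the left side of [fejer2E] vanishes, so [fejer 0 k] is k^2. *)
by have := fejer2E (0 : R) k; rewrite cos0 subrr mul0r => /esym/subr0_eq ->.
Qed.

(** Fejer kernels are nonnegative, so all terms but one odd [d] of the support may be dropped; in
    that term the kernel of index 1, which is constantly 1, survives. *)
Lemma gap_lb : exists2 c, 0 < c & forall t, c <= gap t.
Proof.
have [d [od ad]] := a_odd.
exists (a d * ((sq R q)^-1 ^+ d * ((q%:R - 1) * (2 * 1) / (q%:R + 1)))).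
  rewrite mulr_gt0// mulr_gt0 ?exprn_gt0 ?invr_gt0 ?sq_gt0//.
  by rewrite divr_gt0 ?mulr_gt0 ?subr_gt0// addr_gt0.
move=> t; apply: le_trans (Lam_ge q2 a_ge0 a_sum d (tame_fejer t) (fejer_ge0 t)).
by rewrite ler_wpM2l//; have := Phi_odd_ge q2 (fejer_ge0 t) od; rewrite fejer1.
Qed.

Lemma gap_ub : exists2 c, 0 < c & forall t, gap t <= c.
Proof.
have [B B0 HB] := Lam_bounded; exists B => // t.
by rewrite (le_trans (ler_norm _))// -[leRHS]mul1r HB//; exact: tame_fejer.
Qed.

(** This keeps [lam] away from [- rho]. The sequence 1 + cos(kt) is nonnegative and equals 2 at k =
    0, an index that enters the term of an even [d]. *)
Lemma rhoD_lam_lb : exists2 c, 0 < c & forall t, c <= rho + lam t.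
Proof.
have [d [od ad]] := a_even.
exists (a d * ((sq R q)^-1 ^+ d * ((q%:R - 1) * 2 / (q%:R + 1)))).
  rewrite mulr_gt0// mulr_gt0 ?exprn_gt0 ?invr_gt0 ?sq_gt0//.
  by rewrite divr_gt0 ?mulr_gt0 ?subr_gt0// addr_gt0.
move=> t.
have tN : tame 1 (fun k => -1 * cosn t k).
  by move=> k; rewrite mulN1r normrN; exact: tame_cosn.
have t2 : tame 2 (fun k => 1 - -1 * cosn t k).
  move=> k; rewrite mulN1r opprK -[2]/(1 + 1) mulrDl.
  by rewrite (le_trans (ler_normD _ _))// lerD//; [exact: tame_cst1|exact: tame_cosn].
have -> : rho + lam t = Lam (fun k => 1 - -1 * cosn t k).
  rewrite (LamB q2 a_ge0 a_sum tame_cst1 tN) (LamZ q2 a_ge0 a_sum _ (tame_cosn t)).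
  by rewrite mulN1r opprK.
have g0 k : 0 <= 1 - -1 * cosn t k.
  by rewrite mulN1r opprK addrC -lerBlDr sub0r; exact: cos_geN1.
apply: le_trans (Lam_ge q2 a_ge0 a_sum d t2 g0).
rewrite ler_wpM2l//; apply: le_trans (Phi_even_ge q2 g0 od).
by rewrite cosn0 mulN1r opprK.
Qed.

Lemma rho_gt0 : 0 < rho.
Proof.
have [d [_ ad]] := a_odd.
apply: lt_le_trans (Lam_ge q2 a_ge0 a_sum d tame_cst1 (fun=> ler01)).
by rewrite mulr_gt0// PhiE1// phi_gt0.
Qed.

Lemma ler_norm_lam : exists2 c, 0 < c &
  forall t, `|lam t| <= rho * (1 - c * (1 - cos t)).
Proof.
have [c1 c1_gt0 H1] := gap_lb; have [c2 c2_gt0 H2] := rhoD_lam_lb.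
have r0 := rho_gt0.
(* The gap bound [c1] controls [lam] from above. For [- lam] the bound [c2] is halved, since
   [1 - cos t] is at most 2. *)
exists (Num.min c1 (c2 / 2) / rho).
  by rewrite divr_gt0// lt_min c1_gt0 divr_gt0.
move=> t.
have -> : rho * (1 - Num.min c1 (c2 / 2) / rho * (1 - cos t)) =
    rho - Num.min c1 (c2 / 2) * (1 - cos t) by field; rewrite gt_eqF.
have x0 : 0 <= 1 - cos t by rewrite subr_ge0 cos_le1.
have x2 : 1 - cos t <= 2 by have := cos_geN1 t; lra.
have := rhoB_lam t; have := H1 t; have := H2 t.
rewrite ler_norml => h2 h1 e; apply/andP; split.
  have m_le : Num.min c1 (c2 / 2) <= c2 / 2 by rewrite ge_min lexx orbT.
  have m_ge0 : 0 <= Num.min c1 (c2 / 2) by rewrite le_min !ltW ?divr_gt0.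
  have := ler_pM m_ge0 x0 m_le x2.
  lra.
have : Num.min c1 (c2 / 2) * (1 - cos t) <= gap t * (1 - cos t).
  by rewrite ler_wpM2r// (le_trans _ h1)// ge_min lexx.
lra.
Qed.

Lemma lam_lb : exists2 c, 0 < c & forall t, rho * (1 - c * (1 - cos t)) <= lam t.
Proof.
have [c c_gt0 H] := gap_ub; have r0 := rho_gt0.
exists (c / rho); first by rewrite divr_gt0.
move=> t; have -> : rho * (1 - c / rho * (1 - cos t)) = rho - c * (1 - cos t).
  by field; rewrite gt_eqF.
have x0 : 0 <= 1 - cos t by rewrite subr_ge0 cos_le1.
have := rhoB_lam t; have : (1 - cos t) * gap t <= (1 - cos t) * c by rewrite ler_wpM2l.
lra.
Qed.

Lemma continuous_lam : continuous lam.
Proof.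
by apply: (continuous_Lam q2 a_ge0 a_sum (C := 1)) => [k|t];
  [exact: continuous_cosn|exact: tame_cosn].
Qed.

Lemma continuous_gap : continuous gap.
Proof.
by apply: (continuous_Lam q2 a_ge0 a_sum (C := 1)) => [k|t];
  [exact: continuous_fejer|exact: tame_fejer].
Qed.

Lemma continuous_gap2 : continuous gap2.
Proof.
by apply: (continuous_Lam q2 a_ge0 a_sum (C := 2)) => [k|t];
  [exact: continuous_fejer2|exact: tame_fejer2].
Qed.

End Gap.

(** * The Plancherel measure and the vanishing of the means of nonconstant spherical functions *)

Section Spectral.
Variables (R : realType) (q : nat).
Hypothesis q2 : (2 <= q)%N.
Implicit Types (t : R) (f : R -> R).

Let q1 : 1 < q%:R :> R. Proof. by rewrite ltr1n. Qed.
Let q_gt0 : 0 < q%:R :> R. Proof. exact: lt_trans ltr01 q1. Qed.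
Let q_neq0 : q%:R != 0 :> R. Proof. by rewrite gt_eqF. Qed.

(** The expansion of |1 - e^(2it) / q|^2. *)
Definition wden t : R := 1 + q%:R^-1 ^+ 2 - 2 * q%:R^-1 * cosn t 2.
Definition plw t : R := (wden t)^-1.
Definition nu t : R := (1 - cos t ^+ 2) * plw t.
Definition spec f : R := avg (fun t => nu t * f t) / avg nu.

Lemma wden_lb t : (1 - q%:R^-1) ^+ 2 <= wden t.
Proof.
have h : cosn t 2 <= 1 by exact: cos_le1.
have : 0 <= 2 * q%:R^-1 * (1 - cosn t 2) by rewrite !mulr_ge0 ?invr_ge0// subr_ge0.
rewrite /wden; lra.
Qed.

Let d_gt0 : 0 < (1 - q%:R^-1) ^+ 2 :> R.
Proof. by rewrite exprn_gt0// subr_gt0 invf_lt1. Qed.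

Lemma wden_gt0 t : 0 < wden t. Proof. exact: lt_le_trans (wden_lb t). Qed.

Lemma plw_gt0 t : 0 < plw t. Proof. by rewrite invr_gt0 wden_gt0. Qed.

Lemma continuous_plw : continuous plw.
Proof.
apply: contV => [t|]; first by rewrite gt_eqF ?wden_gt0.
by rewrite /wden /cosn; cont.
Qed.

Lemma plw_ub t : plw t <= ((1 - q%:R^-1) ^+ 2)^-1.
Proof. by rewrite /plw lef_pV2 ?posrE ?wden_gt0// wden_lb. Qed.

Lemma nu_ge0 t : 0 <= nu t.
Proof. by rewrite mulr_ge0 ?(ltW (plw_gt0 t))// -sin2cos2 sqr_ge0. Qed.

Lemma continuous_nu : continuous nu.
Proof. by have cw := continuous_plw; rewrite /nu; cont. Qed.

Lemma avg_nu_gt0 : 0 < avg nu.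
Proof.
apply: (avg_gt0 (t0 := pi / 2) continuous_nu nu_ge0).
  by have := pi_gt0 R; lra.
by rewrite /nu cos_pihalf expr0n subr0 mul1r plw_gt0.
Qed.

Let W k := avg (fun t => plw t * cosn t k).

Let Wbound k : `|W k| <= ((1 - q%:R^-1) ^+ 2)^-1.
Proof.
have cw := continuous_plw.
apply: ler_norm_avg => [|t]; first by rewrite /cosn; cont.
rewrite normrM -[leRHS]mulr1; apply: ler_pM => //; last exact: cosn_le1.
by rewrite ger0_norm ?plw_ub// ltW ?plw_gt0.
Qed.

Let plw_wden t : plw t * (q%:R + q%:R^-1 - 2 * cosn t 2) = q%:R.
Proof.
have -> : q%:R + q%:R^-1 - 2 * cosn t 2 = q%:R * wden t by rewrite /wden; field.
by rewrite mulrCA mulVf ?mulr1// gt_eqF ?wden_gt0.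
Qed.

(** Multiplying the weight by its denominator leaves the constant q, and cos((k+2)t) has average
    0. *)
Let W_rec k : W k + W k.+4 = (q%:R + q%:R^-1) * W k.+2.
Proof.
have cw := continuous_plw.
rewrite /W -avgD; [|by rewrite /cosn; cont..].
rewrite -avgZ; last by rewrite /cosn; cont.
rewrite -[RHS]subr0 -[X in _ - X](mulr0 q%:R) -[X in _ * X](avg_cos R k.+2).
rewrite -avgZ; last by cont.
rewrite -avgB; [|by rewrite /cosn; cont..].
congr avg; apply/funext => t; rewrite -mulrDr -cosn_mul2 -/(cosn t k.+2).
by rewrite -[X in _ - X * _](plw_wden t); ring.
Qed.

(** The case k = -1 of [W_rec], with cos(-t) = cos t. *)
Let W_rec1 : W 1 + W 3 = (q%:R + q%:R^-1) * W 1.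
Proof.
have cw := continuous_plw.
rewrite /W -avgD; [|by rewrite /cosn; cont..].
rewrite -avgZ; last by rewrite /cosn; cont.
rewrite -[RHS]subr0 -[X in _ - X](mulr0 q%:R) -[X in _ * X](avg_cos R 1).
rewrite -avgZ; last by cont.
rewrite -avgB; [|by rewrite /cosn; cont..].
congr avg; apply/funext => t; rewrite -/(cosn t 1).
rewrite -[X in _ - X * _](plw_wden t) !cosnSS cosn0 cosn1; ring.
Qed.

(** In steps of two, the recurrence [W_rec] has characteristic roots q and 1/q. The combination [Y]
    isolates the component of the root q; it would grow like q^i, but the moments [W] are bounded,
    so it is 0. *)
Let W_SS k : W k.+2 = q%:R^-1 * W k.
Proof.
pose Y k := W k.+2 - q%:R^-1 * W k.
have YS j : Y j.+2 = q%:R * Y j.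
  have -> : Y j.+2 = (W j + W j.+4) - W j - q%:R^-1 * W j.+2 by rewrite /Y; ring.
  by rewrite W_rec /Y; field.
have YX i : Y (k + i.*2)%N = q%:R ^+ i * Y k.
  elim: i => [|i IH]; first by rewrite addn0 mul1r.
  by rewrite doubleS !addnS YS IH exprS mulrA.
apply/eqP; rewrite -subr_eq0 -/(Y k) -normr_eq0; apply/eqP/le_anti; rewrite normr_ge0 andbT.
rewrite leNgt; apply/negP => Yk0.
pose B : R := ((1 - q%:R^-1) ^+ 2)^-1 * 2.
have YB j : `|Y j| <= B.
  rewrite (le_trans (ler_normB _ _))// /B -[2]/(1 + 1) mulrDr mulr1 lerD//.
  rewrite normrM -[leRHS]mul1r ler_pM// ger0_norm ?invr_ge0//.
  by rewrite invf_le1 ?ltW.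
have B0 : 0 <= B / `|Y k| by rewrite divr_ge0// (le_trans _ (YB 0%N)).
have := archi_boundP B0; set n := Num.bound _.
rewrite ltNge => /negP; apply; rewrite ler_pdivlMr// (le_trans _ (YB (k + n.*2)%N))//.
rewrite YX normrM ler_wpM2r// normrX ger0_norm// -natrX ler_nat ltnW// ltn_expl//.
Qed.

Let W1 : W 1 = 0.
Proof.
have := W_rec1; rewrite W_SS => /eqP; rewrite -subr_eq0.
have -> : W 1 + q%:R^-1 * W 1 - (q%:R + q%:R^-1) * W 1 = (1 - q%:R) * W 1 by ring.
by rewrite mulf_eq0 subr_eq0 lt_eqF//= => /eqP.
Qed.

(** This is the case n = 0 of the representation of p^(n). For k >= 2, expanding sin^2 t into
    cosines reduces the average to (q+1) W_k - q W_(k+2) - W_(k-2), which vanishes by [W_SS]; k = 1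
    gives a multiple of W_1 - W_3 instead. *)
Lemma spec_sph k : spec (sph q k) = (k == 0%N)%:R.
Proof.
have cw := continuous_plw.
case: k => [|k].
  have -> : spec (sph q 0) = avg nu / avg nu.
    by congr (avg _ / _); apply/funext => t; rewrite sph0// mulr1.
  by rewrite divff// gt_eqF ?avg_nu_gt0.
rewrite /spec; apply/eqP; rewrite mulf_eq0; apply/orP; left.
have : avg (fun t => 2 * sq R q ^+ k.+1 * (q%:R + 1) * (nu t * sph q k.+1 t)) = 0.
  case: k => [|k].
    rewrite (_ : (fun t => _) = fun t =>
        q%:R * (plw t * cosn t 1) - q%:R * (plw t * cosn t 3)); last first.
      apply/funext => t; rewrite /nu expr1.
      have := sph1 q2 t; have := sq_sqr R q; move: (sph q 1 t) (sq R q) => x s sE xE.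
      have -> : 2 * s * (q%:R + 1) * ((1 - cos t ^+ 2) * plw t * x) =
        2 * s * (1 - cos t ^+ 2) * plw t * ((q%:R + 1) * x) by ring.
      rewrite xE !cosnSS cosn0 cosn1 -sE; ring.
    rewrite avgB; [|by rewrite /cosn; cont..].
    rewrite !avgZ; [|by rewrite /cosn; cont..].
    by rewrite -/(W 1) -/(W 3) W_SS W1 !mulr0 subrr.
  rewrite (_ : (fun t => _) = fun t => (q%:R + 1) * (plw t * cosn t k.+2)
      - q%:R * (plw t * cosn t k.+4) - plw t * cosn t k); last first.
    apply/funext => t; rewrite /nu /sph /Phi.
    have sX : sq R q ^+ k.+2 * (sq R q)^-1 ^+ k.+2 = 1.
      by rewrite -exprMn divff ?expr1n// gt_eqF// sq_gt0.
    have -> : 2 * sq R q ^+ k.+2 * (q%:R + 1) * ((1 - cos t ^+ 2) * plw t *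
        ((sq R q)^-1 ^+ k.+2 * (((q%:R - 1) * alt (cosn t) k.+2 + 2 * cosn t k.+2) /
        (q%:R + 1)))) = (sq R q ^+ k.+2 * (sq R q)^-1 ^+ k.+2) * plw t *
        ((q%:R - 1) * (2 * (1 - cos t ^+ 2) * alt (cosn t) k.+2) +
         2 * (2 * (1 - cos t ^+ 2) * cosn t k.+2)).
      field; rewrite gt_eqF//; lra.
    rewrite sX mul1r sin2_altcos !cosnSS; ring.
  rewrite avgB; [|by rewrite /cosn; cont..].
  rewrite avgB; [|by rewrite /cosn; cont..].
  rewrite !avgZ; [|by rewrite /cosn; cont..].
  by rewrite -/(W _) -/(W _) -/(W _) !W_SS; field.
rewrite avgZ; last first.
  apply: contM; first exact: continuous_nu.
  by apply: continuous_Phi => j; exact: continuous_cosn.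
move=> /eqP; rewrite mulf_eq0 => /orP[|//].
rewrite !mulf_eq0 pnatr_eq0/= expf_eq0/= gt_eqF ?sq_gt0//=.
by rewrite gt_eqF// addr_gt0.
Qed.

End Spectral.

(** * Concentration at the top of the spectrum *)

Section Concentration.
Variables (R : realType) (q : nat) (a : nat -> R).
Hypothesis q2 : (2 <= q)%N.
Hypothesis a_ge0 : forall d, 0 <= a d.
Hypothesis a_sum : (fun n => \sum_(0 <= d < n) a d) @ \oo --> (1 : R).
Hypothesis a_odd : exists d, odd d /\ 0 < a d.
Hypothesis a_even : exists d, ~~ odd d /\ 0 < a d.
Implicit Types (t : R) (f : R -> R).
Local Notation lam := (lam q a).
Local Notation rho := (rho q a).
Local Notation nu := (@nu R q).

Let clam : continuous lam. Proof. exact: continuous_lam q2 a_ge0 a_sum. Qed.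
Let cnu : continuous nu. Proof. exact: continuous_nu q2. Qed.
Let rho0 : 0 < rho. Proof. exact: rho_gt0 q2 a_ge0 a_sum a_odd. Qed.
Let nu0 t : 0 <= nu t. Proof. exact: nu_ge0 q2 t. Qed.
Let N0 := avg nu.
Let N0_gt0 : 0 < N0. Proof. exact: avg_nu_gt0. Qed.
Let cnorm : continuous (fun t => `|lam t|).
Proof. by move=> t; apply: cvg_norm; exact: clam. Qed.

Let S n := avg (fun t => nu t * lam t ^+ n).

Lemma exp_ratio_cvg0 (x y e : R) : 0 <= x < y -> 0 < e ->
  \forall n \near \oo, x ^+ n <= e * y ^+ n.
Proof.
move=> /andP[x0 xy] e0; have y0 := le_lt_trans x0 xy.
have /cvgrPdist_le/(_ _ e0) : (fun n => (x / y) ^+ n) @ \oo --> (0 : R).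
  apply: cvg_expr; rewrite ger0_norm ?divr_ge0 ?(ltW y0)//.
  by rewrite ltr_pdivrMr// mul1r.
apply: filterS => n; rewrite sub0r normrN ger0_norm; last first.
  by rewrite exprn_ge0// divr_ge0 ?(ltW y0).
by rewrite expr_div_n ler_pdivrMr// exprn_gt0.
Qed.

Section Cutoff.
Variables c C d : R.
Hypothesis c_gt0 : 0 < c.
Hypothesis C_gt0 : 0 < C.
Hypothesis lam_le : forall t, `|lam t| <= rho * (1 - c * (1 - cos t)).
Hypothesis lam_ge : forall t, rho * (1 - C * (1 - cos t)) <= lam t.
Hypothesis d_gt0 : 0 < d.
Hypothesis d_le1 : d <= 1.
Hypothesis cd_le : c * d <= 2^-1.
Hypothesis Cd_le : C * d <= 1.

Let B := rho * (1 - c * d).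
Let Q := rho * (1 - c * d / 2).

Let cd_gt0 : 0 < c * d. Proof. exact: mulr_gt0. Qed.

Let B_ge0 : 0 <= B.
Proof. by rewrite mulr_ge0 ?(ltW rho0)// subr_ge0 (le_trans cd_le)// invf_le1// ler1n. Qed.

Let BX_ge0 n : 0 <= B ^+ n. Proof. exact: exprn_ge0. Qed.

Let BQ : B < Q.
Proof.
by rewrite ltr_pM2l// ltrD2l ltrN2 ltr_pdivrMr// ltr_pMr// ltr1n.
Qed.

Let Q_gt0 : 0 < Q. Proof. exact: le_lt_trans BQ. Qed.

Let lam_far t n : d < 1 - cos t -> `|lam t| ^+ n <= B ^+ n.
Proof.
move=> dx; rewrite lerXn2r ?nnegrE// (le_trans (lam_le t))// ler_wpM2l ?(ltW rho0)//.
by rewrite lerD2l lerN2 ler_pM2l// ltW.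
Qed.

Let lam_near t : 1 - cos t <= d -> 0 <= lam t.
Proof.
move=> xd; rewrite (le_trans _ (lam_ge t))// mulr_ge0 ?(ltW rho0)// subr_ge0.
by rewrite (le_trans _ Cd_le)// ler_pM2l.
Qed.

Let normX_ge n t : - `|lam t| ^+ n <= lam t ^+ n.
Proof. by rewrite -normrX lerNl -normrN ler_norm. Qed.

(** Where [1 - cos t] is at most [d], [lam] is nonnegative; elsewhere replacing lam^n by its
    absolute value costs at most twice |lam|^n <= B^n. *)
Lemma norm_moment_ptw t n : `|lam t| ^+ n <= lam t ^+ n + 2 * B ^+ n.
Proof.
have [xd|dx] := leP (1 - cos t) d.
  by rewrite ger0_norm ?lam_near// lerDl mulr_ge0.
by have := lam_far n dx; have := normX_ge n t; lra.
Qed.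

(** Near the maximum the weight [1 - cos t] is at most [d]; far from it the weight is at most 2 and
    |lam|^n is at most B^n. Since [d] can be taken arbitrarily small, the weight has a negligible
    mean under lam^n. *)
Lemma weighted_moment_ptw n t :
  `|lam t| ^+ n * (1 - cos t) <= d * lam t ^+ n + 4 * B ^+ n.
Proof.
have x0 : 0 <= 1 - cos t by rewrite subr_ge0 cos_le1.
have x2 : 1 - cos t <= 2 by have := cos_geN1 t; lra.
have ln : 0 <= `|lam t| ^+ n by rewrite exprn_ge0.
have h := norm_moment_ptw t n.
have [xd|dx] := leP (1 - cos t) d.
  have h1 := ler_wpM2l ln xd.
  have h2 := ler_wpM2r (ltW d_gt0) h.
  have h3 := ler_wpM2r (BX_ge0 n) d_le1.
  have h4 := BX_ge0 n.
  rewrite (le_trans h1)// (le_trans h2)// mulrDl mulrC lerD2l.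
  lra.
have h1 := ler_pM ln x0 (lam_far n dx) x2.
have h2 : - B ^+ n <= lam t ^+ n.
  by rewrite (le_trans _ (normX_ge n t))// lerN2 lam_far.
have h3 := ler_wpM2l (ltW d_gt0) h2.
have h4 := ler_wpM2r (BX_ge0 n) d_le1.
have h5 := BX_ge0 n.
by rewrite (le_trans h1)//; lra.
Qed.

Let d' := c * d / 2 / C.
Let d'_gt0 : 0 < d'. Proof. by rewrite !divr_gt0. Qed.
(** A continuous substitute for the indicator function of [1 - cos t < d'], because [le_avg]
    compares continuous integrands; [bump / d'] is at most 1. *)
Let bump t : R := Num.max (d' - (1 - cos t)) 0.

Let bump_ge0 t : 0 <= bump t. Proof. by rewrite le_max lexx orbT. Qed.

Let continuous_bump : continuous bump.
Proof.
have cf : continuous (fun t : R => d' - (1 - cos t)) by cont.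
rewrite (_ : bump = fun t => (d' - (1 - cos t) + `|d' - (1 - cos t)|) / 2).
  apply: contM; last by cont.
  by apply: contD => // t; apply: cvg_norm; exact: cf.
apply/funext => t; rewrite /bump maxr_absE; congr (_ / 2).
by rewrite subr0 addr0.
Qed.

Let avg_bump_gt0 : 0 < avg (fun t => nu t * bump t).
Proof.
have : \forall t \near (0 : R)^'+, 0 < t < pi /\ 1 - d' < cos t.
  near=> t; split.
    apply/andP; split; near: t; first exact: nbhs_right_gt.
    by apply: nbhs_right_lt; exact: pi_gt0.
  near: t; apply: (@cvgr_gt _ _ _ _ cos (cos 0)).
    by apply: cvg_at_right_filter; exact: continuous_cos.
  by rewrite cos0 ltrBlDr ltrDl.
move=> /filter_ex[t [tpi td]].
apply: (avg_gt0 (t0 := t)) => //; first by cont.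
  by move=> s; rewrite mulr_ge0.
apply: mulr_gt0; last first.
  rewrite /bump lt_max; apply/orP; left; lra.
apply: mulr_gt0; last exact: plw_gt0.
by rewrite -sin2cos2 exprn_gt0//; exact: sin_gt0_pi.
Unshelve. all: end_near. Qed.

Let m := avg (fun t => nu t * bump t) / d'.
Let m_gt0 : 0 < m. Proof. exact: divr_gt0. Qed.

Let norm_moment_lb n : m * Q ^+ n <= avg (fun t => nu t * `|lam t| ^+ n).
Proof.
rewrite /m (_ : _ / d' * Q ^+ n = Q ^+ n / d' * avg (fun t => nu t * bump t)); last by ring.
rewrite -avgZ; last by cont.
apply: le_avg; [cont..|] => t.
rewrite mulrCA ler_wpM2l//.
have Qn : 0 <= Q ^+ n by rewrite exprn_ge0// ltW.
have [xd|dx] := leP (1 - cos t) d'; last first.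
  by rewrite /bump max_r ?mulr0 ?exprn_ge0// subr_le0 ltW.
have x0 : 0 <= 1 - cos t by rewrite subr_ge0 cos_le1.
rewrite (@le_trans _ _ (Q ^+ n))//.
  rewrite -mulrA ler_piMr// ler_pdivrMl// mulr1 /bump ge_max (ltW d'_gt0) andbT.
  by rewrite lerBlDr lerDl.
rewrite lerXn2r ?nnegrE ?(ltW Q_gt0)// (le_trans _ (ler_norm _))//.
rewrite (le_trans _ (lam_ge t))// ler_wpM2l ?(ltW rho0)// lerD2l lerN2.
by rewrite mulrC -ler_pdivlMr.
Qed.

Let moment_lb n : m * Q ^+ n - 2 * N0 * B ^+ n <= S n.
Proof.
rewrite lerBlDr (le_trans (norm_moment_lb n))//.
rewrite (_ : 2 * N0 * B ^+ n = avg (fun t => 2 * B ^+ n * nu t)); last first.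
  by rewrite avgZ// /N0; ring.
rewrite -avgD; [|cont..].
apply: le_avg; [cont..|] => t.
by rewrite [X in _ + X]mulrC -mulrDr ler_wpM2l// norm_moment_ptw.
Qed.

Lemma tail_negligible e : 0 < e -> \forall n \near \oo, B ^+ n <= e * S n.
Proof.
(* The first bound makes the negative term of [moment_lb] at most half of m Q^n, so that S n >=
   (m/2) Q^n; the second compares B^n with e times this lower bound. *)
move=> e0; set r := Num.min (m / (4 * N0)) (e * m / 2).
have r0 : 0 < r.
  rewrite lt_min; apply/andP; split; apply: divr_gt0 => //; exact: mulr_gt0.
have BQ' : 0 <= B < Q by rewrite B_ge0.
near=> n.
have h : B ^+ n <= r * Q ^+ n by near: n; exact: exp_ratio_cvg0.
have Qn : 0 < Q ^+ n by rewrite exprn_gt0.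
have h1 : B ^+ n <= m / (4 * N0) * Q ^+ n.
  by rewrite (le_trans h)// ler_pM2r// ge_min lexx.
have h2 : B ^+ n <= e * m / 2 * Q ^+ n.
  by rewrite (le_trans h)// ler_pM2r// ge_min lexx orbT.
have h3 : 2 * N0 * B ^+ n <= m / 2 * Q ^+ n.
  have N2 : 0 <= 2 * N0 by rewrite mulr_ge0// ltW.
  have -> : m / 2 * Q ^+ n = 2 * N0 * (m / (4 * N0) * Q ^+ n).
    by field; rewrite gt_eqF.
  exact: ler_wpM2l.
have h4 : m / 2 * Q ^+ n <= S n by have := moment_lb n; lra.
rewrite (le_trans h2)// (_ : e * m / 2 * Q ^+ n = e * (m / 2 * Q ^+ n)); last by ring.
by rewrite ler_pM2l.
Unshelve. all: end_near. Qed.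

End Cutoff.

(* Where [1 - cos t > d], [|lam t|] is at most [rho * (1 - c * d)], whereas the
   neighbourhood [1 - cos t <= c * d / (2 * C)] of the maximum alone contributes a
   multiple of the n-th power of the larger number [rho * (1 - c * d / 2)]. *)
Lemma moment_estimates : exists2 c : R, 0 < c & forall d0, 0 < d0 -> exists2 d, 0 < d < d0 &
  [/\ forall n t, `|lam t| ^+ n * (1 - cos t) <= d * lam t ^+ n + 4 * (rho * (1 - c * d)) ^+ n,
   0 < rho * (1 - c * d) &
   forall e, 0 < e -> \forall n \near \oo, (rho * (1 - c * d)) ^+ n <= e * S n].
Proof.
have [c c_gt0 Hc] := ler_norm_lam q2 a_ge0 a_sum a_odd a_even.
have [C C_gt0 HC] := lam_lb q2 a_ge0 a_sum a_odd.
exists c => // d0 d0_gt0.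
(* [M * d <= 1] collects the cutoff conditions d <= 1, C d <= 1 and c d <= 1/2. *)
pose M := Num.max (Num.max 1 C) (2 * c).
have M_gt0 : 0 < M by rewrite !lt_max ltr01.
pose d := Num.min (d0 / 2) M^-1.
have d_gt0 : 0 < d by rewrite lt_min divr_gt0// invr_gt0.
have Md : M * d <= 1 by rewrite -ler_pdivlMl// mulr1 ge_min lexx orbT.
have d1 : d <= 1.
  by rewrite (le_trans _ Md)// ler_peMl ?(ltW d_gt0)// !le_max lexx.
have Cd : C * d <= 1.
  by rewrite (le_trans _ Md)// ler_pM2r// !le_max lexx !orbT.
have cd : c * d <= 2^-1.
  rewrite -[leRHS]mulr1 -ler_pdivrMl// invrK mulrA (le_trans _ Md)// ler_pM2r//.
  by rewrite !le_max lexx !orbT.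
exists d; first by rewrite d_gt0/= gt_min ltr_pdivrMr// ltr_pMr// ltr1n.
split.
- by move=> n t; exact: (@weighted_moment_ptw c C).
- by rewrite mulr_gt0// subr_gt0 (le_lt_trans cd)// invf_lt1// ltr1n.
- by move=> e; exact: (@tail_negligible c C).
Qed.

End Concentration.

(** * Limits of ratios and of roots of the radial transition probabilities *)

Section SpectralLimits.
Variables (R : realType) (q : nat) (a : nat -> R).
Hypothesis q2 : (2 <= q)%N.
Hypothesis a_ge0 : forall d, 0 <= a d.
Hypothesis a_sum : (fun n => \sum_(0 <= d < n) a d) @ \oo --> (1 : R).
Hypothesis a_odd : exists d, odd d /\ 0 < a d.
Hypothesis a_even : exists d, ~~ odd d /\ 0 < a d.
Implicit Types (t : R) (f : R -> R).
Local Notation lam := (lam q a).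
Local Notation rho := (rho q a).
Local Notation nu := (@nu R q).

Let clam : continuous lam. Proof. exact: continuous_lam q2 a_ge0 a_sum. Qed.
Let cnu : continuous nu. Proof. exact: continuous_nu q2. Qed.
Let csph k : continuous (sph (R := R) q k).
Proof. by apply: continuous_Phi => j; exact: continuous_cosn. Qed.
Let rho0 : 0 < rho. Proof. exact: rho_gt0 q2 a_ge0 a_sum a_odd. Qed.
Let nu0 t : 0 <= nu t. Proof. exact: nu_ge0 q2 t. Qed.
Let N0_gt0 : 0 < avg nu. Proof. exact: avg_nu_gt0. Qed.
Let S n := avg (fun t => nu t * lam t ^+ n).

Lemma moment_gt0 : \forall n \near \oo, 0 < S n.
Proof.
have [c c_gt0 Hc] := moment_estimates q2 a_ge0 a_sum a_odd a_even.
have [d _ [_ B0 /(_ _ ltr01) HB]] := Hc _ ltr01.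
apply: filterS HB => n; rewrite mul1r; apply: lt_le_trans.
by rewrite exprn_gt0.
Qed.

(** The hypothesis is of first order in [1 - cos t], exactly the weight in [moment_estimates], so
    one pointwise bound of the integrand suffices. *)
Lemma moment_concentration f (K : R) : continuous f ->
  (forall t, `|f 0 - f t| <= K * (1 - cos t)) ->
  avg (fun t => nu t * (lam t ^+ n * f t)) / S n @[n --> \oo] --> f 0.
Proof.
move=> cf fK; have [c c_gt0 Hc] := moment_estimates q2 a_ge0 a_sum a_odd a_even.
apply/cvgrPdist_le => e e0.
have k0 : 0 < `|K| + 1 by rewrite ltr_wpDl.
(* Half of the error is allotted to the term in [d] and half to the term in B^n; [|K| + 1] is a
   positive bound for [K]. *)
pose e' := e / (`|K| + 1) / 2.
have e'0 : 0 < e' by rewrite !divr_gt0.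
have [d /andP[d0 de] [Hd B0 HB]] := Hc _ e'0.
set B := rho * (1 - c * d) in Hd B0 HB.
have r0 : 0 < e' / (4 * avg nu) by rewrite divr_gt0// mulr_gt0.
near=> n.
have Bn : B ^+ n <= e' / (4 * avg nu) * S n by near: n; exact: HB.
have Sn : 0 < S n by near: n; exact: moment_gt0.
rewrite -[X in `|X - _|](mulfK (lt0r_neq0 Sn)) -mulrBl normrM [X in _ * X]ger0_norm; last first.
  by rewrite invr_ge0 ltW.
rewrite ler_pdivrMr//.
rewrite {1}/S -avgZ; last by cont.
rewrite -avgB; [|cont..].
apply: (@le_trans _ _ (avg (fun t =>
    (`|K| + 1) * (d * (nu t * lam t ^+ n) + 4 * B ^+ n * nu t)))).
  apply: ler_norm_avg_le; [cont..|] => t.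
  rewrite (_ : _ - _ = nu t * (lam t ^+ n * (f 0 - f t))); last by ring.
  rewrite normrM ger0_norm// normrM normrX.
  rewrite (_ : (`|K| + 1) * _ =
    nu t * ((`|K| + 1) * (d * lam t ^+ n + 4 * B ^+ n))); last by ring.
  rewrite ler_wpM2l// (@le_trans _ _ ((`|K| + 1) * (`|lam t| ^+ n * (1 - cos t))))//; last first.
    by rewrite ler_wpM2l// ltW.
  rewrite mulrCA ler_wpM2l ?exprn_ge0// (le_trans (fK t))//.
  rewrite ler_wpM2r ?subr_ge0 ?cos_le1//.
  by rewrite (le_trans (ler_norm _))// lerDl.
rewrite avgZ; last by cont.
rewrite avgD; [|cont..].
rewrite !avgZ; [|cont..].
rewrite -/(S n).
have -> : e * S n = (`|K| + 1) * (e' * S n + e' * S n).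
  by rewrite /e'; field; rewrite gt_eqF.
rewrite ler_wpM2l ?(ltW k0)// lerD//; first by rewrite ler_wpM2r// ltW.
have -> : e' * S n = 4 * (e' / (4 * avg nu) * S n) * avg nu by field; rewrite gt_eqF.
by rewrite ler_wpM2r ?(ltW N0_gt0)// ler_wpM2l.
Unshelve. all: end_near. Qed.

(** The candidate for p^(n)(x, y) at distance k; [PnE] proves the identification. *)
Definition pn n k : R := spec q (fun t => lam t ^+ n * sph q k t).

Let pnE n k : pn n k = avg (fun t => nu t * (lam t ^+ n * sph q k t)) / avg nu.
Proof. by []. Qed.

Let pn0E n : pn n 0 = S n / avg nu.
Proof.
by rewrite pnE /S; congr (avg _ / _); apply/funext => t; rewrite sph0// mulr1.
Qed.

Lemma sph_at0 k : sph q k 0 = phi R q k.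
Proof.
rewrite -PhiE1//; congr Phi; apply/funext => j.
by rewrite /cosn mulr0 cos0.
Qed.

Lemma pn_ratio k : pn n k / pn n 0 @[n --> \oo] --> phi R q k.
Proof.
rewrite -sph_at0.
rewrite (_ : (fun n => _) = fun n => avg (fun t => nu t * (lam t ^+ n * sph q k t)) / S n).
  (* By linearity the difference of [sph q k] from its value at 0 is [1 - cos t] times [Phi] of the
     Fejer kernels, and these are bounded by k^2 for indices up to k. *)
  apply: (@moment_concentration _ ((k ^ 2)%:R * phi R q k)); first exact: csph.
  move=> t; rewrite sph_at0 -PhiE1// /sph -PhiB.
  rewrite (_ : (fun j => _) = fun j => (1 - cos t) * fejer t j); last first.
    by apply/funext => j; rewrite fejerE.
  rewrite PhiZ normrM ger0_norm ?subr_ge0 ?cos_le1// mulrC ler_wpM2r ?subr_ge0 ?cos_le1//.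
  rewrite PhiE1//; apply: ler_norm_Phi => // j jk.
  by rewrite (le_trans (ler_norm_fejer _ _))// ler_nat leq_exp2r.
apply/funext => n; rewrite pn0E pnE invf_div mulrA mulfVK//.
by rewrite gt_eqF.
Qed.

Lemma ler_lam_rho t : `|lam t| <= rho.
Proof.
have [c c_gt0 H] := ler_norm_lam q2 a_ge0 a_sum a_odd a_even.
rewrite (le_trans (H t))// ler_piMr ?(ltW rho0)// gerBl mulr_ge0 ?(ltW c_gt0)//.
Qed.

(** From above, |lam| <= rho. From below, the negligible tail is used as a lower bound: (rho (1 - c
    d))^n is eventually at most [pn n 0], for arbitrarily small d. *)
Lemma pn_root : pn n 0 `^ (n%:R^-1) @[n --> \oo] --> rho.
Proof.
have pn_le n : pn n 0 <= rho ^+ n.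
  rewrite pn0E ler_pdivrMr// /S -avgZ//; apply: le_avg; [cont..|] => t.
  rewrite mulrC ler_wpM2r// (le_trans (ler_norm _))// normrX lerXn2r ?nnegrE ?(ltW rho0)//.
  exact: ler_lam_rho.
apply/cvgrPdist_le => e e0.
have [c c_gt0 Hc] := moment_estimates q2 a_ge0 a_sum a_odd a_even.
have [d /andP[d0 de] [_ B0 HB]] := Hc (e / rho / c) (divr_gt0 (divr_gt0 e0 rho0) c_gt0).
near=> n.
have n0 : (0 < n)%N by near: n; exact: nbhs_infty_gt.
have nR : n%:R != 0 :> R by rewrite pnatr_eq0 -lt0n.
have Bn : (rho * (1 - c * d)) ^+ n <= pn n 0.
  rewrite pn0E [leRHS]mulrC; near: n; apply: HB.
  by rewrite invr_gt0.
have rootK (x : R) : 0 <= x -> (x ^+ n) `^ (n%:R^-1) = x.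
  by move=> x0; rewrite -powR_mulrn// -powRrM mulfV// powRr1.
have pn0 : 0 <= pn n 0 by rewrite (le_trans _ Bn)// exprn_ge0// ltW.
have u : pn n 0 `^ n%:R^-1 <= rho.
  rewrite -[leRHS]rootK ?(ltW rho0)// ge0_ler_powR ?nnegrE ?invr_ge0//.
  by rewrite exprn_ge0// ltW.
have l : rho * (1 - c * d) <= pn n 0 `^ n%:R^-1.
  rewrite -[leLHS]rootK ?(ltW B0)// ge0_ler_powR ?nnegrE ?invr_ge0//.
  by rewrite exprn_ge0// ltW.
rewrite ger0_norm ?subr_ge0// lerBlDr.
have : rho * (c * d) <= e.
  rewrite mulrC -ler_pdivlMr// mulrC -ler_pdivlMr//; exact: ltW.
lra.
Unshelve. all: end_near. Qed.

End SpectralLimits.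

(** * The Green function *)

Section GreenFunction.
Variables (R : realType) (q : nat) (a : nat -> R).
Hypothesis q2 : (2 <= q)%N.
Hypothesis a_ge0 : forall d, 0 <= a d.
Hypothesis a_sum : (fun n => \sum_(0 <= d < n) a d) @ \oo --> (1 : R).
Hypothesis a_odd : exists d, odd d /\ 0 < a d.
Hypothesis a_even : exists d, ~~ odd d /\ 0 < a d.
Implicit Types (t : R) (f : R -> R).
Local Notation lam := (lam q a).
Local Notation rho := (rho q a).
Local Notation gap := (gap q a).
Local Notation gap2 := (gap2 q a).
Local Notation nu := (@nu R q).
Local Notation plw := (@plw R q).
Local Notation sq := (@sq R q).

Let q1 : 1 < q%:R :> R. Proof. by rewrite ltr1n. Qed.
Let q_gt0 : 0 < q%:R :> R. Proof. exact: lt_trans ltr01 q1. Qed.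
Let clam : continuous lam. Proof. exact: continuous_lam q2 a_ge0 a_sum. Qed.
Let cnu : continuous nu. Proof. exact: continuous_nu q2. Qed.
Let cplw : continuous plw. Proof. exact: continuous_plw q2. Qed.
Let cgap : continuous gap. Proof. exact: continuous_gap q2 a_ge0 a_sum. Qed.
Let cgap2 : continuous gap2. Proof. exact: continuous_gap2 q2 a_ge0 a_sum. Qed.
Let csph k : continuous (sph (R := R) q k).
Proof. by apply: continuous_Phi => j; exact: continuous_cosn. Qed.
Let rho0 : 0 < rho. Proof. exact: rho_gt0 q2 a_ge0 a_sum a_odd. Qed.
Let N0_gt0 : 0 < avg nu. Proof. exact: avg_nu_gt0. Qed.
Let gap_gt0 t : 0 < gap t.
Proof. by have [c c0 H] := gap_lb q2 a_ge0 a_sum a_odd; exact: lt_le_trans (H t). Qed.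
Let gap_neq0 t : gap t != 0. Proof. by rewrite gt_eqF. Qed.
Let cgapV : continuous (fun t => (gap t)^-1). Proof. exact: contV. Qed.

(** Bernoulli gives N y <= (1 + y)^N, and (1 + y)(1 - y) <= 1. *)
Lemma powB_bernoulli (y : R) N : 0 <= y <= 1 -> N%:R * y * (1 - y) ^+ N <= 1.
Proof.
move=> /andP[y0 y1].
have h : 1 + N%:R * y <= (1 + y) ^+ N.
  elim: N => [|N IH]; first by rewrite mul0r addr0.
  rewrite exprS; apply: le_trans (ler_wpM2l _ IH); last by rewrite addr_ge0.
  rewrite -natr1; have : 0 <= N%:R * y * y by rewrite !mulr_ge0.
  lra.
have y1' : 0 <= (1 - y) ^+ N by rewrite exprn_ge0// subr_ge0.
apply: (@le_trans _ _ ((1 + y) ^+ N * (1 - y) ^+ N)).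
  by rewrite ler_wpM2r// (le_trans _ h)// lerDr.
rewrite -exprMn; apply: exprn_ile1.
  by apply: mulr_ge0; [exact: addr_ge0|rewrite subr_ge0].
by have := sqr_ge0 y; lra.
Qed.

(* Fejer kernels bound the mass near 0: [m ^ 2 = F_m + (1 - cos t) F2_m] with
   [avg F_m = m], while [(1 - cos t) * (lam / rho) ^ N = O(1 / N)]. *)
Lemma avg_lam_pow_cvg0 : avg (fun t => `|lam t / rho| ^+ N) @[N --> \oo] --> (0 : R).
Proof.
have [c0 c0_gt0 Hc0] := ler_norm_lam q2 a_ge0 a_sum a_odd a_even.
(* The cap 1/2 gives c (1 - cos t) <= 1, as [powB_bernoulli] requires. *)
pose c := Num.min c0 2^-1.
have c_gt0 : 0 < c by rewrite lt_min c0_gt0 invr_gt0 ltr0n.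
have x0 t : 0 <= 1 - cos t by rewrite subr_ge0 cos_le1.
have x2 t : 1 - cos t <= 2 by have := cos_geN1 t; lra.
have Hc t : `|lam t / rho| <= 1 - c * (1 - cos t).
  rewrite normrM (ger0_norm (x := rho^-1)) ?invr_ge0 ?(ltW rho0)//.
  rewrite ler_pdivrMr// mulrC (le_trans (Hc0 t))// ler_wpM2l ?(ltW rho0)//.
  by rewrite lerD2l lerN2 ler_wpM2r// ge_min lexx.
have cx t : 0 <= c * (1 - cos t) <= 1.
  have c2 : c <= 2^-1 by rewrite ge_min lexx orbT.
  by have := ler_pM (ltW c_gt0) (x0 t) c2 (x2 t); rewrite mulVf// mulr_ge0// ltW.
have cl : continuous (fun t => `|lam t / rho|).
  by move=> t; apply: cvg_norm; apply: cvgM; [exact: clam|exact: cvg_cst].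
have lN t N : N%:R * c * ((1 - cos t) * `|lam t / rho| ^+ N) <= 1.
  apply: le_trans (powB_bernoulli N (cx t)).
  rewrite mulrA -(mulrA N%:R) ler_wpM2l//.
    by case/andP: (cx t) => ? _; rewrite mulr_ge0.
  by rewrite lerXn2r ?nnegrE// (le_trans _ (Hc t)).
have lN1 t N : `|lam t / rho| ^+ N <= 1.
  rewrite exprn_ile1// (le_trans (Hc t))//.
  by case/andP: (cx t) => ? _; rewrite gerBl.
(* The order m is fixed first to make 1/m small; only then does N grow to remove the second term. *)
have bnd m N : (0 < m)%N -> (0 < N)%N ->
    avg (fun t => `|lam t / rho| ^+ N) <= m%:R^-1 + 2 * m%:R ^+ 2 / (N%:R * c).
  move=> m0 N0.
  have mR : 0 < m%:R :> R by rewrite ltr0n.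
  have NR : 0 < N%:R :> R by rewrite ltr0n.
  have -> : m%:R^-1 + 2 * m%:R ^+ 2 / (N%:R * c) =
      avg (fun t => m%:R ^- 2 * fejer t m + 2 * m%:R ^+ 2 / (N%:R * c)).
    have cf := @continuous_fejer R m.
    rewrite avgD; [|cont..].
    rewrite avgZ// avg_fejer avg_cst; congr (_ + _).
    by field; rewrite gt_eqF.
  have cf := @continuous_fejer R m.
  apply: le_avg; [cont..|] => t.
  have ln0 : 0 <= `|lam t / rho| ^+ N by rewrite exprn_ge0.
  have := fejer2E t m; rewrite natrX => e.
  have -> : `|lam t / rho| ^+ N = m%:R ^- 2 * (fejer t m * `|lam t / rho| ^+ N) +
      m%:R ^- 2 * (fejer2 t m * ((1 - cos t) * `|lam t / rho| ^+ N)).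
    rewrite -mulrDr mulrA -mulrDl [fejer2 t m * _]mulrC e addrC subrK.
    by rewrite mulrA mulVf ?mul1r// expf_neq0// gt_eqF.
  apply: lerD.
    rewrite ler_wpM2l ?invr_ge0 ?exprn_ge0 ?(ltW mR)//.
    by rewrite ler_piMr// fejer_ge0.
  have h1 : (1 - cos t) * `|lam t / rho| ^+ N <= (N%:R * c)^-1.
    by rewrite -[leRHS]mulr1 ler_pdivlMl ?mulr_gt0.
  have h2 := ler_norm_fejer2 t m.
  rewrite -[2 * _ * _](mulKf (x := m%:R ^+ 2)) ?expf_neq0 ?gt_eqF//.
  rewrite ler_wpM2l ?invr_ge0 ?exprn_ge0 ?(ltW mR)//.
  have h3 : 0 <= (1 - cos t) * `|lam t / rho| ^+ N by rewrite mulr_ge0.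
  apply: (le_trans (ler_wpM2r h3 (ler_norm (fejer2 t m)))).
  apply: (le_trans (ler_pM (normr_ge0 _) h3 h2 h1)).
  by rewrite natrM natrX le_eqVlt; apply/orP; left; apply/eqP; ring.
apply/cvgrPdist_le => e e0.
have [m m0 me] : exists2 m, (0 < m)%N & m%:R^-1 <= e / 2.
  have e2 : 0 <= (e / 2)^-1 by rewrite invr_ge0 ltW// divr_gt0.
  exists (Num.bound (e / 2)^-1).+1 => //.
  rewrite invf_ple ?posrE ?divr_gt0// ltW// (lt_le_trans (archi_boundP e2))//.
  by rewrite ler_nat.
near=> N.
rewrite sub0r normrN ger0_norm; last by apply: avg_ge0 => t; rewrite exprn_ge0.
have N0 : (0 < N)%N by near: N; exact: nbhs_infty_gt.
have NR : 0 < N%:R :> R by rewrite ltr0n.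
rewrite (le_trans (bnd m N m0 N0))// [leRHS]splitr lerD//.
rewrite ler_pdivrMr ?mulr_gt0// -ler_pdivrMl ?divr_gt0// -ler_pdivrMr//.
near: N; exact: nbhs_infty_ger.
Unshelve. all: end_near. Qed.

(** This is [nu / (1 - lam / rho)] with the common factor [1 - cos t] cancelled, hence continuous
    also at t = 0, where numerator and denominator both vanish. *)
Let gr t : R := (1 + cos t) * plw t * rho * (gap t)^-1.
Let cgr : continuous gr. Proof. by rewrite /gr; cont. Qed.

Definition green k : R := avg (fun t => gr t * sph q k t) / avg nu.

Lemma gr_nu t : gr t * (1 - lam t / rho) = nu t.
Proof.
have := rhoB_lam q2 a_ge0 a_sum t => e.
have -> : 1 - lam t / rho = (1 - cos t) * gap t / rho.
  by rewrite -e; field; rewrite gt_eqF.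
rewrite /gr /nu; move: (gap t) (plw t) (cos t) (gap_neq0 t) => g p c g0.
by field; rewrite g0 gt_eqF.
Qed.

(** A finite geometric sum in [lam / rho] under the integral, with its exact remainder; [gr_nu]
    makes consecutive remainders telescope. *)
Lemma pn_partial_sum N k : \sum_(0 <= n < N) pn q a n k * rho^-1 ^+ n =
  green k - avg (fun t => gr t * sph q k t * (lam t / rho) ^+ N) / avg nu.
Proof.
elim: N => [|N IH].
  rewrite big_geq// /green -mulrBl -avgB; [|cont..].
  rewrite (_ : (fun t => _) = fun=> 0) ?avg_cst ?mul0r//.
  by apply/funext => t; rewrite mulr1 subrr.
rewrite big_nat_recr//= IH.
suff h : avg (fun t => nu t * (lam t ^+ N * sph q k t)) * rho^-1 ^+ N =
    avg (fun t => gr t * sph q k t * (lam t / rho) ^+ N) -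
    avg (fun t => gr t * sph q k t * (lam t / rho) ^+ N.+1).
  by rewrite /pn /spec [X in _ + X]mulrAC h mulrBl addrA subrK.
rewrite mulrC -avgZ; last by cont.
rewrite -avgB; [|cont..].
congr avg; apply/funext => t.
rewrite -(gr_nu t) exprS !expr_div_n exprVn.
have rN : rho ^+ N != 0 by rewrite expf_neq0 ?gt_eqF.
move: (gr t) (sph q k t) (lam t) rho0 rN => g s l; move: (rho ^+ N) (l ^+ N) => rN lN.
move: rho => r r0 rN0.
by field; rewrite rN0 gt_eqF.
Qed.

Lemma pn_series k : (fun N => \sum_(0 <= n < N) pn q a n k * rho^-1 ^+ n) @ \oo --> green k.
Proof.
have -> : (fun N => \sum_(0 <= n < N) pn q a n k * rho^-1 ^+ n) = fun N =>
    green k - avg (fun t => gr t * sph q k t * (lam t / rho) ^+ N) / avg nu.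
  by apply/funext => N; exact: pn_partial_sum.
suff : (fun N => green k - avg (fun t => gr t * sph q k t * (lam t / rho) ^+ N) / avg nu)
    @ \oo --> green k - 0 / avg nu by rewrite mul0r subr0.
apply: cvgB; first exact: cvg_cst.
apply: cvgM; last exact: cvg_cst.
have [M HM] : exists M, forall t, `|gr t * sph q k t| <= M.
  have [c c0 H] := gap_lb q2 a_ge0 a_sum a_odd.
  exists (2 * ((1 - q%:R^-1) ^+ 2)^-1 * rho * c^-1 * phi R q k) => t.
  have p0 : 0 <= plw t by rewrite ltW// plw_gt0.
  have c1 : 0 <= 1 + cos t by rewrite addrC -lerBlDr sub0r cos_geN1.
  have c2 : 1 + cos t <= 2 by rewrite -[2]/(1 + 1) lerD2l cos_le1.
  have g0 : 0 <= (gap t)^-1 by rewrite invr_ge0 ltW.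
  have gc : (gap t)^-1 <= c^-1 by rewrite lef_pV2 ?posrE.
  rewrite normrM ler_pM//; last exact: sph_le.
  have r0 := ltW rho0.
  rewrite ger0_norm; last by rewrite /gr !mulr_ge0.
  rewrite /gr; apply: ler_pM; rewrite ?mulr_ge0//.
  apply: ler_pM; rewrite ?mulr_ge0//.
  apply: ler_pM; rewrite ?mulr_ge0//.
  exact: plw_ub.
apply: (@cvgn_dominated _ _ (fun N => M * avg (fun t => `|lam t / rho| ^+ N))).
  move=> N; have cl : continuous (fun t => `|lam t / rho|).
    by move=> t; apply: cvg_norm; apply: cvgM; [exact: clam|exact: cvg_cst].
  rewrite sub0r normrN -avgZ; last by cont.
  apply: ler_norm_avg_le; [cont..|] => t.
  by rewrite normrM normrX ler_wpM2r// exprn_ge0.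
have -> : 0 = M * 0 by rewrite mulr0.
by apply: cvgM; [exact: cvg_cst|exact: avg_lam_pow_cvg0].
Qed.

Let psi t : R := plw t * rho * (gap t)^-1.
Let cpsi : continuous psi. Proof. by rewrite /psi; cont. Qed.

(** For the factor 1 / gap the quotient comes from [gap2]; for [plw] it is explicit, since [wden] is
    a quadratic polynomial in cos t. *)
Lemma psi_quotient : exists2 chi : R -> R, continuous chi &
  forall t, psi t - psi 0 = (1 - cos t) * chi t.
Proof.
exists (fun t => rho * (gap t)^-1 * (gap 0)^-1 * plw t * gap2 t -
  rho * (gap 0)^-1 * plw t * plw 0 * (4 * q%:R^-1 * (1 + cos t))).
  by cont.
move=> t; have e1 := gap0B_gap q2 a_ge0 a_sum t.
have e2 : plw t - plw 0 = - (1 - cos t) * (plw t * plw 0 * (4 * q%:R^-1 * (1 + cos t))).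
  have -> : plw t - plw 0 = plw t * plw 0 * (wden q 0 - wden q t).
    have := wden_gt0 q2 (0 : R); have := wden_gt0 q2 t; rewrite /plw.
    by move: (wden q t) (wden q 0) => u v u0 v0; field; rewrite !gt_eqF.
  rewrite /wden !cosn2 cos0; ring.
have -> : psi t - psi 0 = rho * (gap t)^-1 * (gap 0)^-1 * plw t * (gap 0 - gap t) +
    rho * (gap 0)^-1 * (plw t - plw 0).
  rewrite /psi; move: (gap t) (gap 0) (plw t) (plw 0) (gap_neq0 t) (gap_neq0 0).
  by move=> u v w z u0 v0; field; rewrite u0 v0.
rewrite e1 e2.
move: (gap t)^-1 (gap 0)^-1 (plw t) (plw 0) (gap2 t) (cos t) rho => g g0 p p0 h c r.
by ring.
Qed.

(** After q^(-k/2) is removed, the cosine part of the spherical function dies by Riemann-Lebesgue,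
    and the Chebyshev part gives the limit, which is positive because [psi 0] is. *)
Lemma green_asymptotics : exists2 L : R, 0 < L & green k * sq ^+ k @[k --> \oo] --> L.
Proof.
have calt k : continuous (fun t : R => alt (cosn t) k).
  by elim/nat_ind2 : k => [||k IH _] /=; rewrite /cosn; cont.
exists ((q%:R - 1) * psi 0 / (q%:R + 1) / avg nu).
  apply: divr_gt0 => //; apply: divr_gt0; last exact: addr_gt0.
  apply: mulr_gt0; first by rewrite subr_gt0.
  by rewrite /psi mulr_gt0 ?invr_gt0// mulr_gt0// plw_gt0.
rewrite (_ : (fun k => _) = fun k =>
  ((q%:R - 1) * avg (fun t => psi t * ((1 + cos t) * alt (cosn t) k)) +
   2 * avg (fun t => gr t * cosn t k)) / (q%:R + 1) / avg nu); last first.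
  apply/funext => k; rewrite /green mulrAC; congr (_ / _).
  rewrite [LHS]mulrC.
  have cc := @continuous_cosn R k.
  rewrite -!avgZ; [|cont..].
  rewrite -avgD; [|cont..].
  rewrite [RHS]mulrC -avgZ; last by cont.
  congr avg; apply/funext => t; rewrite /sph /Phi /gr /psi exprVn.
  have sk : sq ^+ k != 0 by rewrite expf_neq0 ?gt_eqF ?sq_gt0.
  have qk : q%:R + 1 != 0 :> R by rewrite gt_eqF ?addr_gt0.
  move: (gap t)^-1 (plw t) (cos t) (sq ^+ k) (alt _ k) (cosn t k) rho sk.
  move=> g p c s u v r s0.
  by field; rewrite s0 qk.
do 2 (apply: cvgM; last exact: cvg_cst).
rewrite (_ : (q%:R - 1) * psi 0 = (q%:R - 1) * psi 0 + 2 * 0); last by rewrite mulr0 addr0.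
apply: cvgD; last first.
  by apply: cvgM; [exact: cvg_cst|exact: Riemann_Lebesgue].
apply: cvgM; first exact: cvg_cst.
have [chi cchi Hchi] := psi_quotient.
(* The constant [psi 0] is reproduced exactly, as Dirichlet kernels have mean 1. In the remainder,
   [1 - cos t] and [1 + cos t] combine to sin^2 t, which turns the Chebyshev polynomial into a
   difference of two cosines. *)
have -> : (fun k => avg (fun t => psi t * ((1 + cos t) * alt (cosn t) k))) = fun k =>
  psi 0 + (2^-1 * avg (fun t => chi t * cosn t k) - 2^-1 * avg (fun t => chi t * cosn t (k + 2)%N)).
  apply/funext => k.
  have cD := @continuous_dirichlet R.
  have cc := @continuous_cosn R.
  have -> : psi 0 = psi 0 / 2 * avg (fun t => dirichlet t k) +
      psi 0 / 2 * avg (fun t => dirichlet t k.+1).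
    by rewrite !avg_dirichlet mulr1 -splitr.
  rewrite -!avgZ; [|cont..].
  rewrite -avgB; [|cont..].
  rewrite -avgD; [|cont..].
  rewrite -avgD; [|cont..].
  congr avg; apply/funext => t.
  rewrite -mulrDr -altcos_dirichlet addn2 -mulrBr -mulrBr -sin2_altcos.
  have -> : psi t = psi 0 + (1 - cos t) * chi t by rewrite -Hchi addrC subrK.
  move: (psi 0) (chi t) (cos t) (alt _ k) => p c x u.
  by field.
have e : psi 0 + (2^-1 * 0 - 2^-1 * 0) = psi 0 by rewrite subrr addr0.
have H : (fun k => psi 0 + (2^-1 * avg (fun t => chi t * cosn t k) -
    2^-1 * avg (fun t => chi t * cosn t (k + 2)%N))) @ \oo -->
    psi 0 + (2^-1 * 0 - 2^-1 * 0).
  apply: cvgD; first exact: cvg_cst.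
  apply: cvgB; first by apply: cvgM; [exact: cvg_cst|exact: Riemann_Lebesgue].
  apply: cvgM; first exact: cvg_cst.
  by rewrite (cvg_shiftn 2 (fun k => avg (fun t => chi t * cosn t k))); exact: Riemann_Lebesgue.
by rewrite e in H.
Qed.

End GreenFunction.

(** * Combinatorics of the tree *)

Section Words.
Implicit Types (v w y : seq nat).

Lemma lcp_leq_size v w : (lcp v w <= size v)%N && (lcp v w <= size w)%N.
Proof. by elim: v w => [|a v IH] [|b w] //=; case: ifP => //= _; rewrite !ltnS. Qed.

Lemma lcpC v w : lcp v w = lcp w v.
Proof. by elim: v w => [|a v IH] [|b w] //=; rewrite eq_sym IH. Qed.

Lemma lcp_prefix v w : (lcp v w == size w) = prefix w v.
Proof.
elim: w v => [|b w IH] [|a v] //=.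
by rewrite [a == b]eq_sym; case: (b == a) => //=; rewrite -IH.
Qed.

Lemma lcp_rcons v w c :
  lcp v (rcons w c) = if prefix (rcons w c) v then (size w).+1 else lcp v w.
Proof.
elim: w v => [|b w IH] [|a v] //=; first by rewrite prefix0s andbT eq_sym; case: eqP => // _; case: v.
by rewrite [b == a]eq_sym; case: eqP => //= _; rewrite IH; case: ifP.
Qed.

Lemma prefix_rcons_nth w c v : prefix (rcons w c) v =
  [&& prefix w v, (size w < size v)%N & c == nth 0%N v (size w)].
Proof.
elim: w v => [|b w IH] [|a v] //=; first by rewrite prefix0s andbT.
by rewrite IH ltnS andbA.
Qed.

Lemma wdistC v w : wdist v w = wdist w v.
Proof. by rewrite /wdist lcpC addnC. Qed.

Lemma wdist_eq0 v w : (wdist v w == 0%N) = (v == w).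
Proof.
have [lv lw] := andP (lcp_leq_size v w).
rewrite /wdist subn_eq0; apply/idP/eqP => [h|->]; last first.
  have /eqP -> : lcp w w == size w by rewrite lcp_prefix prefix_refl.
  by lia.
have e1 : lcp v w = size w by lia.
have e2 : size v = size w by lia.
have := lcp_prefix v w; rewrite e1 eqxx => /esym.
by rewrite prefixE -e2 take_size => /eqP.
Qed.

End Words.

Section Neighbours.
Variable q : nat.
Hypothesis q2 : (2 <= q)%N.
Implicit Types (v w y z : seq nat).

Definition nchild w : nat := if w is [::] then q.+1 else q.

Definition nbr w : seq (seq nat) :=
  (if w is a :: s then [:: belast a s] else [::]) ++
  [seq rcons w b | b <- iota 0 (nchild w)].

Lemma is_vert_rcons w b : is_vert q (rcons w b) = is_vert q w && (b < nchild w)%N.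
Proof. by case: w => [|a s] /=; rewrite ?andbT ?ltnS// all_rcons -andbA [(_ < _)%N && _]andbC. Qed.

Lemma nbr_rcons p a : nbr (rcons p a) = p :: [seq rcons (rcons p a) b | b <- iota 0 q].
Proof. by case: p => [|b p] //=; rewrite /nbr/= belast_rcons. Qed.

Lemma is_vert_cat w v : is_vert q (w ++ v) -> is_vert q w.
Proof. by case: w => [//|a w] /=; rewrite all_cat andbA => /andP[]. Qed.

Lemma nbr_uniq w : uniq (nbr w).
Proof.
have h (u : seq nat) n : uniq [seq rcons u b | b <- iota 0 n].
  by rewrite map_inj_uniq ?iota_uniq// => b c /rcons_inj[].
case: (lastP w) => [|p a]; first by rewrite /nbr cat0s; exact: (h [::]).
rewrite nbr_rcons /= h andbT; apply/negP => /mapP[b _ /(congr1 size)].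
by rewrite !size_rcons; lia.
Qed.

Lemma nbr_vert w z : is_vert q w -> z \in nbr w ->
  is_vert q z /\ (size z <= (size w).+1)%N.
Proof.
case: (lastP w) => [|p a] wv.
  by rewrite /nbr => /mapP[b]; rewrite mem_iota add0n ltnS => /= bq ->; rewrite /= bq.
rewrite nbr_rcons inE => /orP[/eqP ->|/mapP[b]].
  by move: wv; rewrite is_vert_rcons size_rcons => /andP[-> _]; split => //; lia.
rewrite mem_iota add0n => bq ->; rewrite is_vert_rcons wv/= !size_rcons; split => //.
by case: (p).
Qed.

Lemma nbr_sub w z : is_vert q w -> is_vert q z -> z \in nbr w -> w \in nbr z.
Proof.
move=> wv zv; case: (lastP w) wv => [|p a] wv.
  by rewrite {1}/nbr => /mapP[b _ ->]; rewrite -[_ [::] b]/(rcons [::] b) (nbr_rcons [::]) mem_head.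
rewrite nbr_rcons inE => /orP[/eqP ->|/mapP[b _ ->]].
  rewrite /nbr mem_cat; apply/orP; right; apply/mapP; exists a => //.
  by rewrite mem_iota; move: wv; rewrite is_vert_rcons => /andP[].
by rewrite nbr_rcons mem_head.
Qed.

Lemma nbr_sym w z : is_vert q w -> is_vert q z -> (z \in nbr w) = (w \in nbr z).
Proof. by move=> wv zv; apply/idP/idP; exact: nbr_sub. Qed.

Section NbrSum.
Variables (R : pzRingType) (f : nat -> R).

Lemma sum_iota_cst n (A : R) : \sum_(b <- iota 0 n) A = A *+ n.
Proof. by rewrite big_const_seq count_predT size_iota -Monoid.iteropE. Qed.

Lemma sum_iota_pick n c (A B : R) : (c < n)%N ->
  \sum_(b <- iota 0 n) (if b == c then A else B) = A + B *+ n.-1.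
Proof.
move=> cn; rewrite (bigD1_seq c) ?iota_uniq ?mem_iota//= eqxx; congr (_ + _).
rewrite (eq_bigr (fun=> B)); last by move=> b /negbTE ->.
rewrite big_const_seq -Monoid.iteropE; congr (_ *+ _).
have := count_predC (pred1 c) (iota 0 n).
rewrite size_iota count_uniq_mem ?iota_uniq// mem_iota/= add0n cn => h.
by rewrite -[in RHS]h add1n.
Qed.

(** A child of [w] is closer to [y] only if it is the next vertex on the geodesic from the root to
    [y]. *)
Let child_dist y w b : is_vert q y -> wdist y (rcons w b) =
  if prefix w y && (size w < size y)%N && (b == nth 0%N y (size w))
  then (wdist y w).-1 else (wdist y w).+1.
Proof.
move=> yv; rewrite /wdist lcp_rcons prefix_rcons_nth andbA size_rcons.
have [lv lw] := andP (lcp_leq_size y w).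
case: ifP => [/andP[/andP[]]|_]; last by lia.
rewrite -lcp_prefix => /eqP e h _; lia.
Qed.

(** For [w] different from [y] exactly one neighbour is closer to [y]: a child if [w] is a proper
    prefix of [y], the parent otherwise. The remaining q neighbours are farther. *)
Lemma nbr_sum y w : is_vert q y -> is_vert q w ->
  \sum_(z <- nbr w) f (wdist y z) =
  if wdist y w is d.+1 then f d + f d.+2 *+ q else f 1%N *+ q.+1.
Proof.
move=> yv wv.
have nth_ok : prefix w y -> (size w < size y)%N -> (nth 0%N y (size w) < nchild w)%N.
  move=> wy sw; have : is_vert q (rcons w (nth 0%N y (size w))).
    have : prefix (rcons w (nth 0%N y (size w))) y by rewrite prefix_rcons_nth wy sw eqxx.
    by move=> /prefixP[s ys]; move: yv; rewrite {1}ys => /is_vert_cat.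
  by rewrite is_vert_rcons => /andP[].
have children : \sum_(b <- iota 0 (nchild w)) f (wdist y (rcons w b)) =
    if prefix w y && (size w < size y)%N then f (wdist y w).-1 + f (wdist y w).+1 *+ (nchild w).-1
    else f (wdist y w).+1 *+ nchild w.
  under eq_bigr do rewrite child_dist//.
  case: ifP => [/andP[wy sw]|_]; last first.
    under eq_bigr do rewrite /=; exact: sum_iota_cst.
  under eq_bigr do rewrite /= (fun_if f).
  by rewrite sum_iota_pick// nth_ok.
have [lv lw] := andP (lcp_leq_size y w).
case: (lastP w) children wv nth_ok lv lw => [|p a] children wv nth_ok lv lw.
  rewrite /nbr cat0s big_map children prefix0s/= /wdist /= lcpC/= addn0 subn0.
  by case: (size y) => [|n].
rewrite nbr_rcons big_cons big_map.
rewrite (_ : nchild (rcons p a) = q) in children; last by case: (p).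
rewrite {}children /wdist.
have := lcp_rcons y p a; have := lcp_prefix y (rcons p a).
have [lp1 lp2] := andP (lcp_leq_size y p).
have := lcp_prefix y p.
rewrite size_rcons in lv lw *.
case: ifP => [pre _ e1 e2|npre _ e1 e2].
  have pp : lcp y p = size p.
    apply/eqP; rewrite lcp_prefix; move: pre; rewrite prefix_rcons_nth.
    by case/and3P.
  rewrite e2 pp in lv lw *.
  have [sy|sy] := ltnP (size p).+1 (size y).
    have [n ->] : exists n, size y = (n + (size p).+2)%N by exists (size y - (size p).+2)%N; lia.
    have -> : (n + (size p).+2 + size p - 2 * size p = n.+2)%N by lia.
    have -> : (n + (size p).+2 + (size p).+1 - 2 * (size p).+1 = n.+1)%N by lia.
    by rewrite addrCA -mulrS prednK// ltnW.
  have -> : size y = (size p).+1 by lia.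
  have -> : ((size p).+1 + size p - 2 * size p = 1)%N by lia.
  have -> : ((size p).+1 + (size p).+1 - 2 * (size p).+1 = 0)%N by lia.
  by rewrite mulrS.
have -> : (size y + (size p).+1 - 2 * lcp y (rcons p a) =
   (size y + size p - 2 * lcp y p).+1)%N by rewrite e2; lia.
by [].
Qed.

End NbrSum.

End Neighbours.

Section Spheres.
Variable q : nat.
Hypothesis q2 : (2 <= q)%N.
Implicit Types (x y z w : seq nat).

Fixpoint words n : seq (seq nat) :=
  if n is m.+1 then [::] :: [seq b :: w | b <- iota 0 q.+1, w <- words m]
  else [:: [::]].

Definition wball n := [seq w <- undup (words n) | is_vert q w].

Lemma words_mem n w : (size w <= n)%N -> all (fun b => (b <= q)%N) w -> w \in words n.
Proof.
elim: n w => [|n IH] [|b w] // sw /andP[bq wq].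
rewrite -[words _]/([::] :: [seq b :: w | b <- iota 0 q.+1, w <- words n]) in_cons.
apply/orP; right; apply/allpairsP; exists (b, w).
by split => //; [rewrite mem_iota ltnS|exact: IH].
Qed.

Lemma wball_uniq n : uniq (wball n).
Proof. by rewrite filter_uniq// undup_uniq. Qed.

Lemma wball_mem n w : is_vert q w -> (size w <= n)%N -> w \in wball n.
Proof.
move=> wv sw; rewrite mem_filter wv mem_undup words_mem//.
case: w wv {sw} => [|a w] //= /andP[-> /=]; apply: sub_all => b; exact: ltnW.
Qed.

Lemma wball_vert n w : w \in wball n -> is_vert q w.
Proof. by rewrite mem_filter => /andP[]. Qed.

Lemma size_wdist x z : (size z <= size x + wdist x z)%N.
Proof. have [l1 l2] := andP (lcp_leq_size x z); rewrite /wdist; lia. Qed.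

Variable R : pzRingType.
Implicit Type f : seq nat -> R.

(** The ball of radius [n] about the root is a finite container; the lemmas ask for it to be large
    enough to hold the sphere about [x]. *)
Definition sphere_sum n x d f : R := \sum_(z <- wball n | wdist x z == d) f z.


Lemma sum_nbr_ball n z f : is_vert q z -> (size z < n)%N ->
  \sum_(w <- nbr q z) f w = \sum_(w <- wball n | w \in nbr q z) f w.
Proof.
move=> zv zn; rewrite -[RHS]big_filter; apply: perm_big; apply: uniq_perm.
- exact: nbr_uniq.
- by rewrite filter_uniq// wball_uniq.
- move=> w; rewrite mem_filter; case wz: (w \in nbr q z) => //=.
  have [wv sw] := nbr_vert q2 zv wz.
  by rewrite wball_mem// (leq_trans sw).
Qed.

(* Double counting of the edges {z, w} with d(x, z) = d. *)
Lemma sphere_sum_nbr n x d f : is_vert q x -> (size x + d < n)%N ->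
  sphere_sum n x d (fun z => \sum_(w <- nbr q z) f w) =
  sphere_sum n x d.+1 f +
  (if d is d'.+1 then (if d' == 0%N then sphere_sum n x 0 f *+ q.+1
                       else sphere_sum n x d' f *+ q) else 0).
Proof.
move=> xv dn.
have bound z : wdist x z = d -> (size z < n)%N.
  by move=> e; have := size_wdist x z; rewrite e; lia.
transitivity (\sum_(z <- wball n | wdist x z == d) \sum_(w <- wball n | w \in nbr q z) f w).
  rewrite /sphere_sum [LHS]big_seq_cond [RHS]big_seq_cond; apply: eq_bigr => z /andP[zb /eqP e].
  exact: sum_nbr_ball (wball_vert zb) (bound _ e).
transitivity (\sum_(w <- wball n) \sum_(z <- wball n | (wdist x z == d) && (z \in nbr q w)) f w).
  rewrite (exchange_big_dep xpredT)//= [LHS]big_seq [RHS]big_seq; apply: eq_bigr => w wb.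
  rewrite big_seq_cond [RHS]big_seq_cond; apply: eq_bigl => z.
  case zb: (z \in wball n) => //=; rewrite nbr_sym//; exact: (wball_vert (n := n)).
(* [nbr_sum] for the indicator function of [d] counts the neighbours of [w] on the sphere. *)
have inner w : w \in wball n ->
    \sum_(z <- wball n | (wdist x z == d) && (z \in nbr q w)) f w =
    f w * (if wdist x w is e.+1 then (e == d)%:R + (e.+2 == d)%:R *+ q else (1%N == d)%:R *+ q.+1).
  move=> wb; have wv := wball_vert wb.
  rewrite -(nbr_sum q2 (fun m => (m == d)%:R) xv wv) mulr_sumr.
  rewrite [RHS](eq_bigr (fun z => if wdist x z == d then f w else 0)); last first.
    by move=> z _; case: ifP => _; rewrite ?mulr1 ?mulr0.
  rewrite -big_mkcond/= -big_filter -[RHS]big_filter; apply: perm_big; apply: uniq_perm.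
  - by rewrite filter_uniq// wball_uniq.
  - by rewrite filter_uniq// nbr_uniq.
  - move=> z; rewrite [LHS]mem_filter [RHS]mem_filter; case e: (wdist x z == d) => //=.
    case zw: (z \in nbr q w) => //=.
    have [zv _] := nbr_vert q2 wv zw.
    by rewrite wball_mem// ltnW// bound//; apply/eqP.
rewrite big_seq (eq_bigr _ inner) -big_seq.
rewrite (eq_bigr (fun w => (if wdist x w == d.+1 then f w else 0) +
  (if d is d'.+1 then (if wdist x w == d' then f w *+ (if d' == 0%N then q.+1 else q) else 0) else 0))); last first.
  move=> w _; case: (wdist x w) => [|e].
    by case: d {dn bound inner} => [|[|d]] /=; rewrite ?mul0rn ?mulr0 ?addr0 ?add0r// mulrnAr mulr1.
  rewrite mulrDr !eqSS; congr (_ + _); first by case: eqP; rewrite ?mulr1 ?mulr0.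
  case: d {dn bound inner} => [|d]; rewrite ?mul0rn ?mulr0//= eqSS.
  case: eqP => [<-|_]/=; last by rewrite mul0rn mulr0.
  by rewrite mulrnAr mulr1.
rewrite big_split/= -big_mkcond/=; congr (_ + _).
case: d {dn bound inner} => [|d]; first by rewrite big1.
rewrite -big_mkcond/= /sphere_sum; case: eqP => [->|_]; by rewrite sumrMnl.
Qed.

End Spheres.

Section SphericalMean.
Variables (R : realType) (q : nat).
Hypothesis q2 : (2 <= q)%N.
Implicit Types (x y z w : seq nat).

(** The number of vertices at distance d from a given vertex. *)
Definition kap d : R := if d is d'.+1 then ((q + 1) * q ^ d')%N%:R else 1.

Lemma kap_gt0 d : 0 < kap d.
Proof. by case: d => [|d] //=; rewrite ltr0n muln_gt0 addn1/= expn_gt0 ltnW. Qed.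

Lemma sph_nbr (t : R) y w : is_vert q y -> is_vert q w ->
  \sum_(z <- nbr q w) sph q (wdist y z) t = 2 * sq R q * cos t * sph q (wdist y w) t.
Proof.
move=> yv wv; rewrite (nbr_sum q2 (fun m => sph q m t) yv wv).
case: (wdist y w) => [|d].
  by rewrite sph0// mulr1 -sph1// -[_ *+ _]mulr_natl -natr1.
by rewrite -[_ *+ _]mulr_natl sphSS// addrC subrK.
Qed.

(** Spherical functions are eigenfunctions of the neighbour sum with eigenvalue 2 sqrt(q) cos t, so
    counting edges gives sphere sums the three-term recurrence that defines [sph] in d. *)
Lemma sphere_sum_sph (t : R) n x y d : is_vert q x -> is_vert q y -> (size x + d <= n)%N ->
  sphere_sum q n x d (fun z => sph q (wdist y z) t) =
  kap d * sph q d t * sph q (wdist y x) t.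
Proof.
move=> xv yv.
have s0 m : (size x <= m)%N -> sphere_sum q m x 0 (fun z => sph q (wdist y z) t) = sph q (wdist y x) t.
  move=> xm; rewrite /sphere_sum (eq_bigl (pred1 x)); last first.
    by move=> z; rewrite wdist_eq0 /= eq_sym.
  by rewrite -big_filter filter_pred1_uniq ?wball_uniq ?wball_mem// big_seq1.
have mean e m : (size x + e < m)%N ->
    sphere_sum q m x e (fun z => \sum_(w <- nbr q z) sph q (wdist y w) t) =
    2 * sq R q * cos t * sphere_sum q m x e (fun z => sph q (wdist y z) t).
  move=> em; rewrite /sphere_sum mulr_sumr [LHS]big_seq_cond [RHS]big_seq_cond; apply: eq_bigr => z /andP[zb _].
  by rewrite sph_nbr//; exact: wball_vert zb.
elim/nat_ind2 : d n => [n xn|n xn|d IH IH1 n dn].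
- by rewrite s0 ?sph0 ?mul1r//; lia.
- have := sphere_sum_nbr q2 (fun z => sph q (wdist y z) t) (d := 0) xv.
  move=> /(_ n); rewrite addn0 => h; have {}h := h ltac:(lia).
  rewrite mean ?addn0 in h; last lia.
  rewrite addr0 s0 in h; last lia.
  by rewrite -h /kap expn0 muln1 natrD sph1.
- have := sphere_sum_nbr q2 (fun z => sph q (wdist y z) t) (d := d.+1) xv.
  move=> /(_ n) h; have {}h := h ltac:(lia).
  rewrite mean in h; last lia.
  rewrite IH1 in h; last lia.
  (* Radius 2 is separate: the centre is reached from all q + 1 of its neighbours, any other vertex
     from only q. *)
  case: d IH IH1 dn h => [|d] IH IH1 dn h.
    rewrite /= s0 in h; last lia.
    rewrite -[LHS](addrK (sph q (wdist y x) t *+ q.+1)) -h.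
    have := sphSS q2 t 0; rewrite sph0// => e.
    rewrite /kap expn0 expn1 muln1 natrM -[sph _ _ _ *+ _]mulr_natl natrD -[q.+1%:R]natr1.
    move: e; move: (sph q 2 t) (sph q 1 t) (sph q (wdist y x) t) (sq R q) (cos t) => u v w s c e.
    apply/esym; transitivity ((q%:R + 1) * (q%:R * u) * w); first by ring.
    by rewrite e; ring.
  rewrite /= IH in h; last lia.
  rewrite -[LHS](addrK ((kap d.+1 * sph q d.+1 t * sph q (wdist y x) t) *+ q)) -h.
  have := sphSS q2 t d.+1 => e.
  rewrite /kap !expnS !natrM -[(_ * _) *+ _]mulr_natl natrD.
  move: e; move: (sph q d.+3 t) (sph q d.+2 t) (sph q d.+1 t) (sph q (wdist y x) t) => u v v' w e.
  apply/esym; transitivity ((q%:R + 1) * (q%:R * (q ^ d)%:R) * (q%:R * u) * w).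
    by ring.
  by rewrite e; ring.
Qed.

End SphericalMean.

(** * Spectral representation of the transition probabilities *)

Section Transition.
Variables (R : realType) (q : nat) (a : nat -> R).
Hypothesis q2 : (2 <= q)%N.
Hypothesis a_ge0 : forall d, 0 <= a d.
Hypothesis a_sum : (fun n => \sum_(0 <= d < n) a d) @ \oo --> (1 : R).
Implicit Types (x y z : vert q).
Local Notation lam := (lam q a).

Lemma PmatE x z : Pmat a x z = a (dist x z) / kap R q (dist x z).
Proof.
apply: cvg_lim => //; apply: cvg_near_cst; near=> n.
have nd : (dist x z < n)%N by near: n; exact: nbhs_infty_gt.
rewrite (bigD1_seq (dist x z)) ?iota_uniq ?mem_index_iota//= big1 ?addr0; last first.
  move=> d /negbTE dn; rewrite /pd [dist x z == d]eq_sym dn; case: eqP => [d0|_]; last by rewrite mulr0.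
  have -> : (x == z) = false; last by rewrite mulr0.
  by apply/negP => /eqP xz; move: dn; rewrite d0 xz eq_sym /dist wdist_eq0 eqxx.
rewrite /pd eqxx; case e : (dist x z) => [|d] /=.
  have -> : x == z by rewrite -val_eqE /= -wdist_eq0; apply/eqP.
  by rewrite invr1.
by [].
Unshelve. all: end_near. Qed.

Definition ball n : seq (vert q) := pmap insub (wball q n).

Lemma map_val_ball n : [seq val x | x <- ball n] = wball q n.
Proof.
rewrite /ball (pmap_filter (@insubK _ _ _)) (eq_filter (a2 := is_vert q)).
  by apply/all_filterP/allP => w; exact: wball_vert.
by move=> w; rewrite isSome_insub.
Qed.

Definition sphere x d : seq (vert q) := [seq z <- ball (size (val x) + d) | dist x z == d].

Lemma sphere_mem x d z : (z \in sphere x d) = (dist x z == d).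
Proof.
rewrite mem_filter; case: eqP => //= <-.
rewrite -(mem_map val_inj) map_val_ball wball_mem//; first exact: valP.
exact: size_wdist.
Qed.

Lemma sphere_uniq x d : uniq (sphere x d).
Proof. by rewrite filter_uniq// -(map_inj_uniq val_inj) map_val_ball wball_uniq. Qed.

Lemma sum_sphere_sph x y d t :
  \sum_(z <- sphere x d) sph q (dist z y) t = kap R q d * sph q d t * sph q (dist x y) t.
Proof.
have := sphere_sum_sph q2 t (valP x) (valP y) (leqnn (size (val x) + d)).
rewrite /sphere_sum -map_val_ball big_map -big_filter /dist (wdistC (val x)) => <-.
by apply: eq_bigr => z _; rewrite wdistC.
Qed.

Let clam : continuous lam. Proof. exact: continuous_lam q2 a_ge0 a_sum. Qed.
Let cnu : continuous (@nu R q). Proof. exact: continuous_nu q2. Qed.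
Let csph k : continuous (sph (R := R) q k).
Proof. by apply: continuous_Phi => j; exact: continuous_cosn. Qed.

Lemma Pn_ge0 n x y : 0 <= Pn a n x y.
Proof.
elim: n x y => [|n IH] x y /=; first by rewrite ler0n.
apply/fine_ge0/esum_ge0 => z _; rewrite lee_fin mulr_ge0//.
by rewrite PmatE divr_ge0// ltW// kap_gt0.
Qed.

(** The partial sums of [lam] converge uniformly in t, so summing over d commutes with the spectral
    average and produces one more factor [lam]. *)
Lemma spec_step n k :
  (fun N => \sum_(0 <= d < N) a d * spec q (fun t => lam t ^+ n * (sph q d t * sph q k t)))
    @ \oo --> pn q a n.+1 k.
Proof.
have [B B0 HB] := Lam_upto_tail q2 a_ge0 a_sum.
have [c c_gt0 Hc] := Lam_bounded q2 a_ge0 a_sum.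
have lamc t : `|lam t| <= c by rewrite -[leRHS]mul1r; apply: Hc; exact: tame_cosn.
rewrite (_ : (fun N => _) = fun N => avg (fun t => nu q t *
    (lam t ^+ n * (Lam_upto q a N (cosn t) * sph q k t))) / avg (nu q)); last first.
  apply/funext => N; rewrite /spec.
  rewrite (_ : (fun t => _) = fun t => \sum_(0 <= d < N)
      a d * (nu q t * (lam t ^+ n * (sph q d t * sph q k t)))); last first.
    apply/funext => t; rewrite /Lam_upto mulr_suml mulr_sumr mulr_sumr.
    by apply: eq_bigr => d _; rewrite /sph; ring.
  rewrite avg_sum; last by move=> d; cont.
  rewrite mulr_suml; apply: eq_bigr => d _.
  by rewrite avgZ ?mulrA//; cont.
apply: cvgM; last exact: cvg_cst.
have -> : (fun t => nu q t * (lam t ^+ n.+1 * sph q k t)) =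
    fun t => nu q t * (lam t ^+ n * (lam t * sph q k t)).
  by apply/funext => t; rewrite exprSr -!mulrA.
pose M := ((1 - q%:R^-1) ^+ 2)^-1 * (c ^+ n * phi R q k).
apply: (@avg_uniform_cvg _ _ _ (fun N => M * (1 * B * atail a N))).
- move=> N.
  have cL : continuous (fun t => Lam_upto q a N (cosn t)).
    rewrite /Lam_upto; apply: cont_sum => d; apply: contM; first by cont.
    exact: csph.
  by cont.
- move=> N t.
  rewrite (_ : _ - _ = nu q t * (lam t ^+ n * sph q k t) * (lam t - Lam_upto q a N (cosn t))); last by ring.
  rewrite normrM ler_pM//; last by apply: HB; exact: tame_cosn.
  rewrite normrM ler_pM//.
    have s0 : 0 <= 1 - cos t ^+ 2 by rewrite -sin2cos2 sqr_ge0.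
    have s1 : 1 - cos t ^+ 2 <= 1 by rewrite gerBl sqr_ge0.
    have p0 := ltW (plw_gt0 q2 t).
    by rewrite ger0_norm ?nu_ge0// /nu -[leRHS]mul1r ler_pM ?plw_ub.
  rewrite normrM ler_pM ?sph_le// normrX lerXn2r ?nnegrE ?(ltW c_gt0)//.
- have -> : 0 = M * (1 * B * 0) by rewrite !mulr0.
  apply: cvgM; first exact: cvg_cst.
  by apply: cvgM; [exact: cvg_cst|exact: atail_cvg].
Qed.

(** Induction on n: the first step is grouped by its length d, and the mean value property on the
    sphere about [x] replaces the sum over its end points by the product of two spherical
    functions. *)
Lemma PnE n x y : Pn a n x y = pn q a n (dist x y).
Proof.
elim: n x y => [|n IH] x y /=.
  rewrite /pn (_ : (fun t => _) = sph q (dist x y)) ?spec_sph//; last first.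
    by apply/funext => t; rewrite mul1r.
  by rewrite /dist wdist_eq0 -val_eqE.
pose F d : set (vert q) := [set z | dist x z = d].
have FT : [set: vert q] = \bigcup_d F d.
  by apply/seteqP; split => // z _; exists (dist x z).
have tF : trivIset setT F by move=> i j _ _ [z [/= <- <-]].
rewrite FT (nneseries_sum_bigcup tF); last first.
  by move=> z; rewrite lee_fin mulr_ge0 ?Pn_ge0// PmatE divr_ge0// ltW// kap_gt0.
have term d : (\esum_(z in F d) (Pmat a x z * Pn a n z y)%:E)%E =
    (a d * spec q (fun t => lam t ^+ n * (sph q d t * sph q (dist x y) t)))%:E.
  have FE : F d = [set` sphere x d].
    by apply/seteqP; split => z /=; rewrite sphere_mem => /eqP.
  rewrite FE esum_fset; first last.
  - by move=> z _; rewrite lee_fin mulr_ge0 ?Pn_ge0// PmatE divr_ge0// ltW// kap_gt0.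
  - exact: finite_seq.
  rewrite -fsbig_seq ?sphere_uniq// sumEFin; congr EFin.
  rewrite big_seq (eq_bigr (fun z => a d / kap R q d * pn q a n (dist z y))); last first.
    by move=> z; rewrite sphere_mem => /eqP e; rewrite PmatE IH e.
  rewrite -big_seq -mulr_sumr /pn /spec -mulr_suml -avg_sum; last by move=> z; cont.
  rewrite (_ : (fun t => _) = fun t => kap R q d *
      (nu q t * (lam t ^+ n * (sph q d t * sph q (dist x y) t)))); last first.
    apply/funext => t; rewrite -!mulr_sumr sum_sphere_sph; ring.
  rewrite avgZ; last by cont.
  have := kap_gt0 R q2 d; move: (kap R q d) (avg _) (avg (nu q))^-1 => k A B k0.
  by field; rewrite gt_eqF.
under eq_eseriesr do rewrite term.
suff -> : (\sum_(0 <= d <oo) (a d * spec q (fun t => lam t ^+ n *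
    (sph q d t * sph q (dist x y) t)))%:E)%E = (pn q a n.+1 (dist x y))%:E by [].
apply: cvg_lim => //.
rewrite (_ : (fun N => _) = EFin \o (fun N => \sum_(0 <= d < N) a d * spec q (fun t => lam t ^+ n *
    (sph q d t * sph q (dist x y) t)))); last by apply/funext => N; rewrite /= sumEFin.
by apply: cvg_EFin; [exact: nearW|exact: spec_step].
Qed.

End Transition.

(** * The end compactification *)

Section EndTopology.
Variable q : nat.
Implicit Types (x y v : vert q) (xi eta : endT q) (w : seq nat).

Lemma tc_cvg (F : set_system (tc q)) (p : tc q) : Filter F ->
  (forall i, @tc_subbase q i p -> F (@tc_subbase q i)) -> F --> p.
Proof.
move=> FF Fp A /=; rewrite (@nbhsE (tc q)).
move=> [_ [[B sB <-] [C BC Cp] sUBA]].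
rewrite nbhs_filterE; apply: filterS sUBA _; apply: (@filterS _ _ _ C).
  by move=> ? ?; exists C.
have /sB [D sD IDeC] := BC; rewrite -IDeC; apply: filter_bigI => i Di.
by apply: Fp; move: Cp; rewrite -IDeC => /(_ _ Di).
Qed.

Lemma tc_open i : open (@tc_subbase q i : set (tc q)).
Proof.
exists [set @tc_subbase q i]; last by rewrite bigcup_set1.
move=> _ ->; exists (fset1 i); last by rewrite set_fset1 bigcap_set1.
by move=> j _; rewrite in_setT.
Qed.

Lemma tc_nbhs i (p : tc q) : tc_subbase i p -> nbhs p (@tc_subbase q i).
Proof. by move=> ip; apply: open_nbhs_nbhs; split => //; exact: tc_open. Qed.

Lemma cone0 : @cone q [::] = setT.
Proof. by apply/seteqP; split => // -[v|xi] _ /=; rewrite ?take0. Qed.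

Lemma open_vertex v : open [set (inl v : tc q)].
Proof.
rewrite (_ : [set _] = @tc_subbase q (true, val v)); first exact: tc_open.
by apply/seteqP; split => [_ ->|[y|xi]] //= /val_inj ->.
Qed.

Lemma end_vert xi n : is_vert q (mkseq (sval xi) n).
Proof.
case: xi => f [f0 fS] /=; case: n => [//|n].
rewrite /mkseq /= f0 -[1%N]addn0 iotaDl -map_comp all_map.
by apply/allP => m _ /=; exact: fS.
Qed.

Definition end_vertex xi n : vert q :=
  exist (fun w => is_true (is_vert q w)) _ (end_vert xi n).

Lemma take_mkseq (f : nat -> nat) m n : (m <= n)%N -> take m (mkseq f n) = mkseq f m.
Proof.
move=> mn; apply: (@eq_from_nth _ 0%N); first by rewrite size_takel size_mkseq// size_mkseq.
move=> i; rewrite size_takel ?size_mkseq// => im.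
by rewrite nth_take// !nth_mkseq// (leq_trans im).
Qed.

Lemma end_vertex_cvg xi : (fun n => inl (end_vertex xi n) : tc q) @ \oo --> (inr xi : tc q).
Proof.
apply: tc_cvg => -[[|] w] //= wE.
exists (size w) => // n /= wn.
by change (w = take (size w) (mkseq (sval xi) n)); rewrite take_mkseq.
Qed.

Lemma closure_vertices : closure (range (fun v => inl v : tc q)) = setT.
Proof.
apply/seteqP; split => // -[v|xi] _ B Bp.
  by exists (inl v); split; [exists v|exact: nbhs_singleton Bp].
have [N _ NB] := end_vertex_cvg Bp.
by exists (inl (end_vertex xi N)); split; [exists (end_vertex xi N)|apply: NB => /=].
Qed.

Lemma end_eq xi eta : (forall n, mkseq (sval xi) n = mkseq (sval eta) n) -> xi = eta.
Proof.
case: xi eta => [f hf] [g hg] /= e.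
have fg : f = g.
  apply/funext => n; have := congr1 (fun s => nth 0%N s n) (e n.+1).
  by rewrite !nth_mkseq.
by move: hf hg; rewrite fg => hf hg; congr exist; exact: Prop_irrelevance.
Qed.

Lemma cone_inj w1 w2 (p : tc q) : size w1 = size w2 -> cone w1 p -> cone w2 p -> w1 = w2.
Proof.
by case: p => [v|xi] /= e h1 h2;
  [apply: etrans h1 (etrans (congr1 (fun n => take n _) e) (esym h2))
  |apply: etrans h1 (etrans (congr1 (mkseq _) e) (esym h2))].
Qed.

Lemma cone_end xi n : @cone q (mkseq (sval xi) n) (inr xi).
Proof. by rewrite /cone /= size_mkseq. Qed.

Lemma cone_nbhs xi n : nbhs (inr xi : tc q) (@cone q (mkseq (sval xi) n)).
Proof.
have := @tc_nbhs (false, mkseq (sval xi) n) (inr xi); apply.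
exact: cone_end.
Qed.

Lemma tc_hausdorff : hausdorff_space (tc q).
Proof.
have far v xi : ~ cluster (nbhs (inl v : tc q)) (inr xi : tc q).
  move=> /(_ [set (inl v : tc q)] (@cone q (mkseq (sval xi) (size (val v)).+1))).
  have h1 : nbhs (inl v : tc q) [set (inl v : tc q)].
    by apply: open_nbhs_nbhs; split => //; exact: open_vertex.
  move=> /(_ h1 (cone_nbhs _ _))[_ [->]] /= /(congr1 size).
  by rewrite size_mkseq size_take; case: ifP; lia.
move=> [v|xi] [y|eta] cl.
- have h z : nbhs (inl z : tc q) [set (inl z : tc q)].
    by apply: open_nbhs_nbhs; split => //; exact: open_vertex.
  by have [_ [-> /= ->]] := cl _ _ (h v) (h y).
- by case: (far _ _ cl).
- move: cl; rewrite [in X in X -> _](_ : cluster _ _ = cluster (nbhs (inl y : tc q)) (inr xi)).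
    by move/far.
  by apply/propeqP; split => cl A B hA hB; rewrite setIC; exact: cl.
- congr inr; apply: end_eq => n.
  have [p [p1 p2]] := cl _ _ (cone_nbhs xi n) (cone_nbhs eta n).
  by apply: cone_inj p1 p2; rewrite !size_mkseq.
Qed.

Lemma ultra_finite_union (T : Type) (F : set_system T) (B : set T) (A : nat -> set T) n :
  UltraFilter F -> F (B `|` [set z | exists2 b, (b < n)%N & A b z]) ->
  F B \/ exists2 b, (b < n)%N & F (A b).
Proof.
move=> FU; elim: n => [|n IH] FBA.
  by left; apply: filterS FBA => z [//|[b]].
have [FA|FA] := in_ultra_setVsetC (A n) FU.
  by right; exists n.
case: IH => [|FB|[b bn Fb]]; [|by left|by right; exists b => //; exact: ltnW].
apply: filterS (filterI FBA FA) => z [[Bz|[b bn Abz]] Az]; first by left.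
right; exists b => //; move: bn; rewrite ltnS leq_eqVlt => /orP[/eqP bn|//].
by rewrite bn in Abz.
Qed.

Lemma cone_split w : is_vert q w -> @cone q w `<=`
  @tc_subbase q (true, w) `|` [set z | exists2 b, (b < nchild q w)%N & cone (rcons w b) z].
Proof.
move=> wv [v|xi] /= e.
  have [sv|sv] := leqP (size (val v)) (size w).
    by left; rewrite e take_oversize.
  right; exists (nth 0%N (val v) (size w)); last first.
    by rewrite size_rcons (take_nth 0%N)// -e.
  have : is_vert q (take (size w).+1 (val v)).
    by apply: (@is_vert_cat q _ (drop (size w).+1 (val v))); rewrite cat_take_drop; exact: valP.
  by rewrite (take_nth 0%N)// -e is_vert_rcons => /andP[].
right; exists (sval xi (size w)); last by rewrite size_rcons mkseqS -e.
by have := end_vert xi (size w).+1; rewrite mkseqS -e is_vert_rcons => /andP[].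
Qed.

(** A Koenig argument: an ultrafilter that contains no vertex singleton and contains the cone of a
    word also contains the cone of one of its finitely many children. The letters so chosen spell an
    end, its limit. *)
Lemma tc_compact : compact [set: tc q].
Proof.
rewrite compact_ultra => F FU _.
have [[v Fv]|nv] := pselect (exists v, F [set (inl v : tc q)]).
  exists (inl v); split => //; apply: tc_cvg => i iv.
  by apply: filterS Fv => _ ->.
have /choice[g Hg] : forall w, exists b, is_vert q w -> F (@cone q w) ->
    (b < nchild q w)%N /\ F (@cone q (rcons w b)).
  move=> w; have [[wv Fw] |nw] := pselect (is_vert q w /\ F (@cone q w)); last first.
    by exists 0%N => wv Fw; case: nw.
  have /ultra_finite_union[] : F (@tc_subbase q (true, w) `|`
      [set z | exists2 b, (b < nchild q w)%N & cone (rcons w b) z]).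
  - by apply: filterS Fw; exact: cone_split.
  - move=> Fs; case: nv; exists (exist (fun w => is_true (is_vert q w)) w wv).
    by apply: filterS Fs => -[y|//] /= yw; congr inl; apply: val_inj.
  - by move=> [b bw Fb]; exists b.
pose W n := iter n (fun w => rcons w (g w)) [::].
have WP n : is_vert q (W n) /\ F (@cone q (W n)).
  elim: n => [|n [Wv FW]]; first by split => //=; rewrite cone0; exact: filterT.
  by have [gw Fg] := Hg _ Wv FW; split => //=; rewrite is_vert_rcons Wv.
have gW n : (g (W n) < nchild q (W n))%N by have [Wv FW] := WP n; have [] := Hg _ Wv FW.
have xiP : (g (W 0%N) <= q)%N /\ forall n, (g (W n.+1) < q)%N.
  split => [|n]; first by have := gW 0%N; rewrite /= ltnS.
  by have := gW n.+1; rewrite /=; case: (W n).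
pose xi : endT q := exist _ (fun n => g (W n)) xiP.
have WE n : mkseq (sval xi) n = W n by elim: n => // n IH; rewrite mkseqS IH.
exists (inr xi); split => //; apply: tc_cvg => -[[|] w] //= e.
have Fw := (WP (size w)).2.
have ew : w = W (size w) := etrans e (WE (size w)).
by rewrite -ew in Fw.
Qed.

End EndTopology.

(** * Boundary values and continuous extension of radial kernels *)

Section KernelExtension.
Variables (R : realType) (q : nat).
Hypothesis q2 : (2 <= q)%N.
Implicit Types (x y v : vert q) (xi eta : endT q) (w : seq nat).

Let q1 : 1 < q%:R :> R. Proof. by rewrite ltr1n. Qed.
Let q_gt0 : 0 < q%:R :> R. Proof. exact: lt_trans ltr01 q1. Qed.

Lemma lcp_take (u w : seq nat) : lcp u w = lcp u (take (size u) w).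
Proof. by elim: u w => [|a u IH] [|b w] //=; case: ifP => // _; rewrite -IH. Qed.

Definition clen x xi := lcp (val x) (mkseq (sval xi) (size (val x))).

Lemma clen_le x xi : (clen x xi <= size (val x))%N.
Proof. by have /andP[] := lcp_leq_size (val x) (mkseq (sval xi) (size (val x))). Qed.

Lemma horE x xi : hor x xi = (size (val x) - clen x xi)%:Z - (clen x xi)%:Z.
Proof.
rewrite /hor /conf_end -/(clen x xi) size_takel ?clen_le//; congr (Posz _ - _).
have cl := clen_le x xi.
have e : lcp (val x) (take (clen x xi) (val x)) = clen x xi.
  have := lcp_prefix (val x) (take (clen x xi) (val x)).
  by rewrite prefix_take size_takel// => /eqP.
by rewrite /wdist e size_takel//; lia.
Qed.

Lemma sqVX n : (sq R q)^-1 ^+ n = q%:R `^ (- (n%:R / 2)).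
Proof.
rewrite powRN -[n%:R / 2]mulrC powRrM powR12_sqrt ?ler0n// powR_mulrn ?sqrtr_ge0//.
by rewrite exprVn.
Qed.

(** This quotient of natural powers is the form in which limits of g(m + i) / g(m + j) appear. *)
Lemma bvalE x xi : bval R x xi =
  (sq R q)^-1 ^+ (size (val x) - clen x xi) / (sq R q)^-1 ^+ clen x xi.
Proof.
rewrite /bval horE !sqVX -powRN -powRD; last by apply/implyP => _; rewrite gt_eqF.
congr (_ `^ _); rewrite rmorphB/= -!pmulrn; ring.
Qed.

Lemma cone_lcp w x v : @cone q w (inl v) -> (size (val x) <= size w)%N ->
  lcp (val x) (val v) = lcp (val x) (take (size (val x)) w).
Proof.
by move=> /= e sw; rewrite [LHS]lcp_take; congr lcp; rewrite [in RHS]e take_takel.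
Qed.

Section Continuity.
Variable g : nat -> R.
Hypothesis g_neq0 : \forall m \near \oo, g m != 0.
Hypothesis g_ratio : g m.+1 / g m @[m --> \oo] --> (sq R q)^-1.

Lemma ratio_shift j : g (m + j)%N / g m @[m --> \oo] --> (sq R q)^-1 ^+ j.
Proof.
elim: j => [|j IH].
  apply: cvg_near_cst; apply: filterS g_neq0 => m gm.
  by rewrite addn0 divff.
have h : g (m + j).+1 / g (m + j)%N * (g (m + j)%N / g m) @[m --> \oo] -->
    (sq R q)^-1 * (sq R q)^-1 ^+ j.
  apply: cvgM IH.
  by rewrite (cvg_shiftn j (fun m => g m.+1 / g m)).
rewrite exprS; apply: cvg_trans h; apply: near_eq_cvg.
have g' : \forall m \near \oo, g (m + j)%N != 0.
  have [N _ NH] := g_neq0; exists N => // m /= Nm; apply: NH => /=.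
  by rewrite (leq_trans Nm) ?leq_addr.
near=> m; rewrite addnS mulrA mulfVK//; near: m; exact: g'.
Unshelve. all: end_near. Qed.

Lemma ratio_shift2 i j : g (m + i)%N / g (m + j)%N @[m --> \oo] -->
  (sq R q)^-1 ^+ i / (sq R q)^-1 ^+ j.
Proof.
have h : g (m + i)%N / g m / (g (m + j)%N / g m) @[m --> \oo] -->
    (sq R q)^-1 ^+ i / (sq R q)^-1 ^+ j.
  apply: cvgM; first exact: ratio_shift.
  apply: cvgV; last exact: ratio_shift.
  by rewrite expf_neq0// invr_neq0// gt_eqF// sq_gt0.
apply: cvg_trans h; apply: near_eq_cvg; near=> m.
have gm : g m != 0 by near: m.
by rewrite invf_div mulrA mulfVK.
Unshelve. all: end_near. Qed.

(** Deep in the cone of [xi] the confluent with [x] has constant length c, so with m = |y| - c the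
    kernel is g(m + (|x| - c)) / g(m + c). Ends in that cone have exactly the boundary value of
    [xi]. *)
Lemma continuous_ext_kernel (k : vert q -> vert q -> R) :
  (forall x y, k x y = g (dist x y) / g (vnorm y)) ->
  forall x, continuous (ext_kernel k x).
Proof.
move=> kE x [v|xi].
  move=> A /= Av; apply: (@filterS _ _ _ [set (inl v : tc q)]).
    by move=> _ ->; exact: nbhs_singleton Av.
  by apply: open_nbhs_nbhs; split => //; exact: open_vertex.
move=> A /nbhs_ballP[e /= e0 eA].
set c := clen x xi; set n := size (val x).
have cn : (c <= n)%N by exact: clen_le.
have /cvgrPdist_lt/(_ _ e0)[N _ HN] := @ratio_shift2 (n - c) c.
(* Depth n fixes the confluent with [x]; N further letters force |y| - c >= N, since c <= n. *)
apply: (@filterS _ _ _ (@cone q (mkseq (sval xi) (n + N)))); last first.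
  exact: cone_nbhs.
move=> p h; apply: eA; case: p h => [y|eta] h /=.
  have lE : lcp (val x) (val y) = c.
    rewrite (cone_lcp h) ?size_mkseq ?leq_addr// take_mkseq ?leq_addr//.
  have sy : (n + N <= size (val y))%N.
    have := congr1 size h; rewrite /= size_mkseq => ->.
    by rewrite size_take; case: ifP => //; lia.
  rewrite kE /dist /wdist lE /vnorm bvalE -/c -/n.
  have -> : (n + size (val y) - 2 * c = (size (val y) - c) + (n - c))%N by lia.
  have {2}-> : size (val y) = ((size (val y) - c) + c)%N by lia.
  have sN : (N <= size (val y) - c)%N by lia.
  exact: HN _ sN.
suff -> : bval R x eta = bval R x xi by exact: ballxx.
suff e1 : clen x eta = clen x xi by rewrite !bvalE e1.
have h' : mkseq (sval xi) (n + N) = mkseq (sval eta) (n + N) by move: h; rewrite /= size_mkseq.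
by rewrite /clen -/n -(take_mkseq _ (leq_addr N n)) -h' take_mkseq ?leq_addr.
Qed.

End Continuity.

(** The test vertex lies on the ray to [xi], beyond the point where [eta] branches off, so its
    confluent with [eta] is strictly shorter. *)
Lemma bval_separates xi eta : xi <> eta -> exists x, bval R x xi <> bval R x eta.
Proof.
move=> ne; have [n ne_n] : exists n, mkseq (sval xi) n <> mkseq (sval eta) n.
  by apply/existsNP => h; apply: ne; exact: end_eq.
exists (end_vertex xi n); rewrite !bvalE /= size_mkseq.
have c1 : clen (end_vertex xi n) xi = n.
  rewrite /clen /= size_mkseq; apply/eqP; rewrite -{3}(size_mkseq (sval xi) n) lcp_prefix.
  exact: prefix_refl.
have c2 : (clen (end_vertex xi n) eta < n)%N.
  have := clen_le (end_vertex xi n) eta; rewrite /= size_mkseq leq_eqVlt => /orP[|//].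
  rewrite /clen /= size_mkseq -{3}(size_mkseq (sval eta) n) lcp_prefix => /prefixP[s e].
  case: ne_n; have s0 : s = [::].
    have := congr1 size e; rewrite size_cat !size_mkseq => h.
    by apply: size0nil; lia.
  by rewrite e s0 cats0.
set r := (sq R q)^-1; set m := clen _ eta in c2 *.
have r0 : 0 < r by rewrite invr_gt0 sq_gt0.
have r1 : r != 1 by rewrite lt_eqF// invf_lt1 ?sq_gt0 ?sq_gt1.
rewrite c1 subnn mul1r => /(congr1 (fun u => u * r ^+ n * r ^+ m)).
rewrite mulVf ?mul1r ?expf_neq0 ?gt_eqF//.
rewrite [RHS]mulrAC mulfVK ?expf_neq0 ?gt_eqF// -exprD => /(ieexprIn r0 r1); lia.
Qed.

Lemma end_compactification (k : vert q -> vert q -> R) :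
  (forall x, continuous (ext_kernel k x)) ->
  kernel_compactification (@inl (vert q) (endT q) : vert q -> tc q) k (ext_kernel k).
Proof.
move=> ck; split.
  split; [exact: tc_compact|exact: tc_hausdorff|by move=> x y []|exact: open_vertex|].
  exact: closure_vertices.
split => // -[v|xi] [y|eta]; try by move=> h; case: h; eexists.
  by move=> _ h; case: h; eexists.
move=> _ _ ne; have [x hx] : exists x, bval R x xi <> bval R x eta.
  by apply: bval_separates => e; apply: ne; rewrite e.
by exists x.
Qed.

End KernelExtension.

(** * Both kernels as quotients of a radial function *)

Section Ratios.
Variables (R : realType) (q : nat) (a : nat -> R).
Hypothesis q2 : (2 <= q)%N.
Hypothesis a_ge0 : forall d, 0 <= a d.
Hypothesis a_sum : (fun n => \sum_(0 <= d < n) a d) @ \oo --> (1 : R).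
Hypothesis a_odd : exists d, odd d /\ 0 < a d.
Hypothesis a_even : exists d, ~~ odd d /\ 0 < a d.
Implicit Types (x y : vert q).
Local Notation rho := (rho q a).

Lemma dist_troot y : dist (troot q) y = vnorm y.
Proof. by rewrite /dist /wdist /= muln0 subn0. Qed.

Lemma spec_radE : spec_rad q a = rho.
Proof.
have [_] := cvg_limn_inf_sup (pn_root q2 a_ge0 a_sum a_odd a_even).
rewrite /spec_rad => <-; congr limn_sup; apply/funext => n.
by rewrite PnE// dist_troot.
Qed.

Lemma GreenE x y : Green a x y = green q a (dist x y).
Proof.
rewrite /Green /rconv spec_radE.
suff -> : (\sum_(0 <= n <oo) (Pn a n x y * rho^-1 ^+ n)%:E)%E = (green q a (dist x y))%:E by [].
apply: cvg_lim => //.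
rewrite (_ : (fun N => _) = EFin \o (fun N => \sum_(0 <= n < N) pn q a n (dist x y) * rho^-1 ^+ n)).
  by apply: cvg_EFin; [exact: nearW|exact: pn_series].
by apply/funext => N; rewrite /= sumEFin; congr EFin; apply: eq_bigr => n _; rewrite PnE.
Qed.

(** The term n = 0 is 1 and the others are nonnegative. Positivity lets G(y, y) cancel in
    [Kmartin]. *)
Lemma Green_diag_gt0 y : 0 < Green a y y.
Proof.
rewrite GreenE; have -> : dist y y = 0%N by apply/eqP; rewrite /dist wdist_eq0.
apply: lt_le_trans ltr01 _.
have h := @pn_series R q a q2 a_ge0 a_sum a_odd a_even 0%N.
apply: (cvgn_ge (b := 1) (N := 1) h) => -[|N] // _.
have p0 n : 0 <= pn q a n 0.
  have -> : 0%N = dist (troot q) (troot q) by [].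
  by rewrite -PnE// Pn_ge0.
rewrite big_nat_recl//= expr0 mulr1.
have -> : pn q a 0 0 = 1.
  transitivity (Pn a 0 (troot q) (troot q)); first by rewrite PnE.
  by rewrite /Pn eqxx.
rewrite lerDl sumr_ge0// => n _; rewrite mulr_ge0// exprn_ge0// invr_ge0.
by rewrite ltW// rho_gt0.
Qed.

Lemma KmartinE x y : Kmartin a x y = green q a (dist x y) / green q a (vnorm y).
Proof.
have := Green_diag_gt0 y; rewrite /Kmartin /Ffun; move: (Green a y y) => G G0.
by rewrite !GreenE dist_troot invf_div mulrA divfK// gt_eqF.
Qed.

Lemma green_neq0 : \forall m \near \oo, green q a m != 0.
Proof.
have [L L0 HL] := green_asymptotics q2 a_ge0 a_sum a_odd.
near=> m; have : 0 < green q a m * sq R q ^+ m.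
  by near: m; apply: (cvgr_gt L); [exact: HL|exact: L0].
by apply: contraTneq => ->; rewrite mul0r ltxx.
Unshelve. all: end_near. Qed.

Lemma green_ratio : green q a m.+1 / green q a m @[m --> \oo] --> (sq R q)^-1.
Proof.
have [L L0 HL] := green_asymptotics q2 a_ge0 a_sum a_odd.
have s0 := sq_gt0 R q2.
have h : green q a m.+1 * sq R q ^+ m.+1 / (green q a m * sq R q ^+ m) / sq R q @[m --> \oo] -->
    L / L / sq R q.
  apply: cvgM; last exact: cvg_cst.
  apply: cvgM; last by apply: cvgV HL; rewrite gt_eqF.
  by rewrite (cvg_shiftS (fun m => green q a m * sq R q ^+ m)).
rewrite -[(sq R q)^-1]mul1r -(divff (lt0r_neq0 L0)).
apply: cvg_trans h; apply: near_eq_cvg; near=> m.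
have g0 : green q a m != 0 by near: m; exact: green_neq0.
by rewrite exprS; field; rewrite g0 expf_neq0 ?gt_eqF.
Unshelve. all: end_near. Qed.

Lemma phi_ratio : phi R q m.+1 / phi R q m @[m --> \oo] --> (sq R q)^-1.
Proof.
have q1 : 1 < q%:R :> R by rewrite ltr1n.
have s0 := sq_gt0 R q2.
pose c : R := (q%:R - 1) / (q%:R + 1).
have c0 : 0 <= c by rewrite divr_ge0; lra.
have c1 : c <= 1 by rewrite ler_pdivrMr; lra.
have d0 m : 0 < 1 + c * m%:R by rewrite ltr_pwDl// mulr_ge0.
have phiE n : phi R q n = (1 + c * n%:R) * (sq R q)^-1 ^+ n by rewrite /phi -sqVX.
clearbody c.
have -> : (fun m => phi R q m.+1 / phi R q m) = fun m => (1 + c / (1 + c * m%:R)) * (sq R q)^-1.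
  apply/funext => m; rewrite !phiE !exprVn exprS -natr1.
  have := d0 m; move: (m%:R) => u u0.
  by field; rewrite expf_neq0 !gt_eqF.
rewrite -[X in _ --> X]mul1r; apply: cvgM; last exact: cvg_cst.
rewrite -[1 in X in _ --> X]addr0; apply: cvgD; first exact: cvg_cst.
(* As c <= 1, the correction c / (1 + c m) is at most 1 / (m + 1). *)
apply: (@cvgn_dominated _ _ harmonic); last exact: cvg_harmonic.
move=> m; rewrite sub0r normrN ger0_norm; last by rewrite divr_ge0// ltW.
rewrite /harmonic /= ler_pdivrMr// mulrC ler_pdivlMr// -natr1 mulrDr mulr1.
by rewrite addrC lerD2r.
Qed.

End Ratios.

Unset Implicit Arguments.

Theorem theorem3p1 (R : realType) (q : nat) (a : nat -> R) :
  (2 <= q)%N ->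
  (forall d, 0 <= a d) ->
  (fun n => \sum_(0 <= d < n) a d) @ \oo --> (1 : R) ->
  (exists d, odd d /\ 0 < a d) ->
  (exists d, ~~ odd d /\ 0 < a d) ->
  limn_sup (fun d => a d `^ (d%:R^-1)) = 0 ->
  (* ratio limit theorem, with ratio limit kernel H = phi(d(x,y))/phi(|y|) *)
  (exists h : vert q -> vert q -> R,
     (forall x y, 0 < h x y /\
        (fun n => Pn a n x y / Pn a n (troot q) (troot q)) @ \oo --> h x y) /\
     (forall x y, h x y / h (troot q) y = Hker R x y)) /\
  (* the end compactification T u dT, with boundary values q^(-hor(x,xi)/2),
     is the ratio limit compactification ... *)
  kernel_compactification (@inl (vert q) (endT q) : vert q -> tc q)
    (@Hker R q) (ext_kernel (@Hker R q)) /\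
  (* ... and is the rho-Martin compactification, with the same extended
     kernel: K(x,xi|rho) = H(x,xi) = q^(-hor(x,xi)/2) *)
  kernel_compactification (@inl (vert q) (endT q) : vert q -> tc q)
    (Kmartin a) (ext_kernel (Kmartin a)).
Proof.
move=> q2 a_ge0 a_sum a_odd a_even _; split; last split.
- exists (fun x y => phi R q (dist x y)); split => x y; last by rewrite /Hker dist_troot.
  split; first exact: phi_gt0.
  rewrite (_ : (fun n => _) = fun n => pn q a n (dist x y) / pn q a n 0).
    exact: pn_ratio.
  by apply/funext => n; rewrite !PnE.
- apply: end_compactification => //.
  apply: (continuous_ext_kernel q2 (g := phi R q)) => //; last exact: phi_ratio.
  by apply: nearW => m; rewrite gt_eqF// phi_gt0.
- apply: end_compactification => //.
  apply: (continuous_ext_kernel q2 (g := green q a)).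
  + exact: green_neq0.
  + exact: green_ratio.
  + by move=> x y; exact: KmartinE.
Qed.
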